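(* Let $f\in\mathrm{AC}^1$, let $x\in[-1,1]$ and let $n_j$ be a sequence such that \[ \lim_{j\to\infty} n_j\,\big(B_{n_j}(f,x)-f(x)\big)=L\in\overline{\mathbb{R}}.\qquad(\ast) \] (i) Suppose $n_j$ is odd. If $x$ is irrational then $L\in\mathcal{O}(f,x):=\big[-\tfrac{2|O(f,x)|}{\pi},\tfrac{2|O(f,x)|}{\pi}\big]$. If $x$ is rational then the set $\mathcal{O}(x)$ defined below is a finite subset of $\mathbb{R}\setminus\{0\}$, and if $x$ is regular for $n_j$ then $L\in\mathcal{O}(f,x):=\{O(f,x)/y:\ y\in\mathcal{O}(x)\}$. Conversely (for $x$ irrational, or rational in $(-1,1)$), if $L\in\mathcal{O}(f,x)$ then there exists an odd sequence $n_j$ for which $x$ is regular and $(\ast)$ holds. (ii) Suppose $n_j$ is even. If $x$ is irrational then $L\in\mathcal{E}(f,x):=\big[-\tfrac{2|E(f,x)|}{\pi},\tfrac{2|E(f,x)|}{\pi}\big]$. If $x$ is rational then the set $\mathcal{E}(x)$ defined below is a finite subset of $\mathbb{R}\setminus\{0\}$, and if $x$ is regular for $n_j$ then $L\in\mathcal{E}(f,x):=\{E(f,x)/y:\ y\in\mathcal{E}(x)\}$. Conversely, if $L\in\mathcal{E}(f,x)$ then there exists an even sequence $n_j$ for which $x$ is regular and $(\ast)$ holds.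
   Context: Nodes: $x_{k,n}:=2k/n-1$, $k=0,\dots,n$. Berrut's interpolant: $B_n(f,x):=N_n(f,x)/D_n(x)$ for $x$ not a node, $B_n(f,x_{k,n}):=f(x_{k,n})$, with $N_n(f,x)=\sum_{k=0}^n(-1)^k\frac{f(x_{k,n})}{x-x_{k,n}}$, $D_n(x)=\sum_{k=0}^n(-1)^k\frac{1}{x-x_{k,n}}$. $\mathrm{AC}^1$ is the class of $f:[-1,1]\to\mathbb{R}$ that are differentiable at every point of $[-1,1]$ (one-sided derivatives at $\pm1$) with $f'$ absolutely continuous on $[-1,1]$. A ''sequence $n_j$'' is a strictly increasing function $\mathbb{N}\to\mathbb{N}$, $j\mapsto n_j$; it is odd (even) if every $n_j$ is odd (even). A point $x\in[-1,1]$ is regular for $n_j$ if there is $j_0$ such that for $j\ge j_0$, $x\notin\{x_{0,n_j},\dots,x_{n_j,n_j}\}$. $\overline{\mathbb{R}}=\mathbb{R}\cup\{+\infty,-\infty\}$ is the two-point compactification with its usual topology. For $x\in(-1,1)$, \[ O(f,x):=\frac{f(x)-f(1)}{2(x-1)}-\frac{f(x)-f(-1)}{2(x+1)},\qquad E(f,x):=\frac{f(1)-f(x)}{2(x-1)}+\frac{f(-1)-f(x)}{2(x+1)}. \] For rational $x\in(-1,1)$, $\mathcal{O}(x)$ is the set of all $y\in\overline{\mathbb{R}}$ such that $\lim_{j\to\infty}D_{n_j}(x)/n_j=y$ for some odd sequence $n_j$ for which $x$ is regular; $\mathcal{E}(x)$ is defined in the same way with even sequences. *)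

(* Defs.v *)
From Stdlib Require Import Reals ZArith List ClassicalDescription.
From Coquelicot Require Import Coquelicot.
Open Scope R_scope.

Fixpoint sumR (m : nat) (g : nat -> R) : R :=
  match m with
  | O => 0
  | S m' => sumR m' g + g m'
  end.

Definition node (n k : nat) : R := 2 * INR k / INR n - 1.

Definition is_node (n : nat) (x : R) : Prop :=
  exists k : nat, (k <= n)%nat /\ x = node n k.

Definition Nb (n : nat) (f : R -> R) (x : R) : R :=
  sumR (S n) (fun k => (-1) ^ k * f (node n k) / (x - node n k)).

Definition Db (n : nat) (x : R) : R :=
  sumR (S n) (fun k => (-1) ^ k / (x - node n k)).

Definition Berrut (n : nat) (f : R -> R) (x : R) : R :=
  if excluded_middle_informative (is_node n x) then f x else Nb n f x / Db n x.

(* Absolute continuity of g on [a,b]: finite families of non-overlapping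
   subintervals (u_k, v_k), listed in increasing order. *)
Definition abs_cont_on (g : R -> R) (a b : R) : Prop :=
  forall eps : R, 0 < eps -> exists delta : R, 0 < delta /\
    forall (m : nat) (u v : nat -> R),
      (forall k, (k < m)%nat -> a <= u k /\ u k <= v k /\ v k <= b) ->
      (forall k, (S k < m)%nat -> v k <= u (S k)) ->
      sumR m (fun k => v k - u k) < delta ->
      sumR m (fun k => Rabs (g (v k) - g (u k))) < eps.

Definition AC1 (f : R -> R) : Prop :=
  exists f' : R -> R,
    (forall t, -1 < t < 1 -> is_derive f t (f' t)) /\
    filterlim (fun h => (f (-1 + h) - f (-1)) / h) (at_right 0) (locally (f' (-1))) /\
    filterlim (fun h => (f (1 + h) - f 1) / h) (at_left 0) (locally (f' 1)) /\
    abs_cont_on f' (-1) 1.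

Definition strictly_incr (n : nat -> nat) : Prop :=
  forall i j : nat, (i < j)%nat -> (n i < n j)%nat.
Definition odd_seq (n : nat -> nat) : Prop := forall j, Nat.odd (n j) = true.
Definition even_seq (n : nat -> nat) : Prop := forall j, Nat.even (n j) = true.

Definition regular (x : R) (n : nat -> nat) : Prop :=
  exists j0 : nat, forall j, (j0 <= j)%nat -> ~ is_node (n j) x.

Definition rational (x : R) : Prop :=
  exists p q : Z, q <> 0%Z /\ x = IZR p / IZR q.
Definition irrational (x : R) : Prop := ~ rational x.

Definition Ofun (f : R -> R) (x : R) : R :=
  (f x - f 1) / (2 * (x - 1)) - (f x - f (-1)) / (2 * (x + 1)).
Definition Efun (f : R -> R) (x : R) : R :=
  (f 1 - f x) / (2 * (x - 1)) + (f (-1) - f x) / (2 * (x + 1)).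

Definition Ocal (x : R) (y : Rbar) : Prop :=
  exists n : nat -> nat, strictly_incr n /\ odd_seq n /\ regular x n /\
    is_lim_seq (fun j => Db (n j) x / INR (n j)) y.
Definition Ecal (x : R) (y : Rbar) : Prop :=
  exists n : nat -> nat, strictly_incr n /\ even_seq n /\ regular x n /\
    is_lim_seq (fun j => Db (n j) x / INR (n j)) y.

Definition finite_nonzero_real (S : Rbar -> Prop) : Prop :=
  (exists l : list Rbar, forall y, S y -> In y l) /\
  (forall y, S y -> exists r : R, y = Finite r /\ r <> 0).

Definition in_sym_interval (c : R) (L : Rbar) : Prop :=
  Rbar_le (Finite (- c)) L /\ Rbar_le L (Finite c).

Definition OfxSet (f : R -> R) (x : R) (L : Rbar) : Prop :=
  (irrational x /\ in_sym_interval (2 * Rabs (Ofun f x) / PI) L) \/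
  (rational x /\ exists r : R, Ocal x (Finite r) /\ L = Finite (Ofun f x / r)).
Definition EfxSet (f : R -> R) (x : R) (L : Rbar) : Prop :=
  (irrational x /\ in_sym_interval (2 * Rabs (Efun f x) / PI) L) \/
  (rational x /\ exists r : R, Ecal x (Finite r) /\ L = Finite (Efun f x / r)).

Definition star (f : R -> R) (x : R) (n : nat -> nat) (L : Rbar) : Prop :=
  is_lim_seq (fun j => INR (n j) * (Berrut (n j) f x - f x)) L.

(* Main.v *)
(* Write t = n (x + 1) / 2. Since x - x_k = (2 / n) (t - k), D_n(x) / n is half the sum of
   (-1)^k / (t - k), and n (B_n - f) is the quotient of N_n - f(x) D_n by D_n / n.
   The numerator is an alternating sum of the difference quotients of f at x; it tends to
   O(f,x) or E(f,x) because summation by parts leaves half the boundary terms, plus an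
   alternating sum of increments which is small near x by absolute continuity of f' and away
   from x because consecutive increments cancel. The product sin(pi t) D_n / n tends to pi / 2,
   by comparing sum sin((t - k) u) / (t - k) at u = pi with primitives of Dirichlet kernels of
   order floor(t) and n - floor(t). Hence n (B_n - f) behaves like 2 A sin(pi t) / pi with
   A = O(f,x) or E(f,x). For rational x the phase sin(pi t) is periodic in n and does not
   vanish off the nodes; for irrational x it is dense in [-1, 1] along each parity class. *)

Require Import Defs.
From Stdlib Require Import Reals Lra Lia ZArith List Classical ClassicalEpsilon.
From Coquelicot Require Import Coquelicot.
Open Scope R_scope.

(** * Finite sums, termwise calculus and the mean value theorem *)

Lemma sumR_ext (m : nat) (a b : nat -> R) :
  (forall k, (k < m)%nat -> a k = b k) -> sumR m a = sumR m b.
Proof.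
induction m as [|m IH]; intros H; simpl; [easy|].
rewrite IH, H; auto with arith.
Qed.

Lemma sumR_le (m : nat) (a b : nat -> R) :
  (forall k, (k < m)%nat -> a k <= b k) -> sumR m a <= sumR m b.
Proof.
induction m as [|m IH]; intros H; simpl; [lra|].
apply Rplus_le_compat; auto with arith.
Qed.

Lemma sumR_plus (m : nat) (a b : nat -> R) :
  sumR m (fun k => a k + b k) = sumR m a + sumR m b.
Proof. induction m as [|m IH]; simpl; [lra|]. rewrite IH; ring. Qed.

Lemma sumR_scal (m : nat) (c : R) (a : nat -> R) :
  sumR m (fun k => c * a k) = c * sumR m a.
Proof. induction m as [|m IH]; simpl; [lra|]. rewrite IH; ring. Qed.

Lemma sumR_const (m : nat) (c : R) : sumR m (fun _ => c) = INR m * c.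
Proof. induction m as [|m IH]; [simpl; ring|]. rewrite S_INR; simpl; rewrite IH; ring. Qed.

Lemma sumR_telescope (m : nat) (a : nat -> R) :
  sumR m (fun k => a (S k) - a k) = a m - a O.
Proof. induction m as [|m IH]; simpl; [ring|]. rewrite IH; ring. Qed.

Lemma is_derive_sumR (m : nat) (F dF : nat -> R -> R) (u : R) :
  (forall k, (k < m)%nat -> is_derive (F k) u (dF k u)) ->
  is_derive (fun v => sumR m (fun k => F k v)) u (sumR m (fun k => dF k u)).
Proof.
induction m as [|m IH]; intros H; simpl.
- apply (is_derive_const (K := R_AbsRing) (V := R_NormedModule) 0 u).
- apply (is_derive_plus (K := R_AbsRing) (V := R_NormedModule)
           (fun v => sumR m (fun k => F k v)) (F m)); auto with arith.
Qed.

Lemma continuity_pt_sumR (m : nat) (F : nat -> R -> R) (u : R) :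
  (forall k, (k < m)%nat -> continuity_pt (F k) u) ->
  continuity_pt (fun v => sumR m (fun k => F k v)) u.
Proof.
induction m as [|m IH]; intros H; simpl.
- apply continuity_pt_const; intros a b; reflexivity.
- apply (continuity_pt_plus (fun v => sumR m (fun k => F k v)) (F m)); auto with arith.
Qed.

Lemma is_derive_continuity_pt (F : R -> R) (u l : R) : is_derive F u l -> continuity_pt F u.
Proof.
intros H; apply continuity_pt_filterlim.
apply (ex_derive_continuous (K := R_AbsRing) (V := R_NormedModule) F); now exists l.
Qed.

(** The point [c] has to be interior: later uses know the derivative, or a bound on it, only there,
    either because [sin (u / 2)] vanishes at 0 or because the points reach the ends of [[-1, 1]]. *)
Lemma mean_value (F dF : R -> R) (a b : R) :
  a < b ->
  (forall c, a < c < b -> is_derive F c (dF c)) ->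
  (forall c, a <= c <= b -> continuity_pt F c) ->
  exists c, a < c < b /\ F b - F a = dF c * (b - a).
Proof.
intros Hab HD HC.
assert (pr : forall c, a < c < b -> derivable_pt F c).
{ intros c Hc; exists (dF c); apply is_derive_Reals; auto. }
assert (pr' : forall c, a < c < b -> derivable_pt id c).
{ intros c _; apply derivable_pt_id. }
destruct (MVT F id a b pr pr' Hab HC) as [c [Hc E]].
{ intros c _; apply derivable_continuous_pt, derivable_pt_id. }
exists c; split; [exact Hc|].
assert (E1 : derive_pt F c (pr c Hc) = dF c).
{ apply derive_pt_eq_0, is_derive_Reals; auto. }
assert (E2 : derive_pt id c (pr' c Hc) = 1).
{ apply derive_pt_eq_0, derivable_pt_lim_id. }
rewrite E1, E2 in E; unfold id in E; lra.
Qed.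

(** * The partial fractions of the cosecant *)

Lemma Rabs_sin_le (u : R) : Rabs (sin u) <= Rabs u.
Proof.
assert (H : forall v, 0 <= v -> Rabs (sin v) <= v).
{ intros v Hv. destruct (Req_dec v 0) as [->|Hv0]; [rewrite sin_0, Rabs_R0; lra|].
  destruct (mean_value sin cos 0 v) as [c [_ E]]; [lra| | |].
  - intros c _; apply is_derive_sin.
  - intros c _; eapply is_derive_continuity_pt, is_derive_sin.
  - rewrite sin_0, !Rminus_0_r in E; rewrite E, Rabs_mult, (Rabs_pos_eq v) by easy.
    rewrite <- (Rmult_1_l v) at 2; apply Rmult_le_compat_r; [easy|].
    apply Rabs_le; apply COS_bound. }
destruct (Rle_dec 0 u) as [Hu|Hu].
- rewrite (Rabs_pos_eq u) by easy; auto.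
- rewrite <- (Rabs_Ropp u), <- (Rabs_Ropp (sin u)), <- sin_neg, (Rabs_pos_eq (- u)) by lra.
  apply H; lra.
Qed.

(** Truncated Taylor series at [v = u / 2 <= 2]: there [1 - v^2 / 6 >= 1 / 3], and the terms of
    order 5 and 7 have a nonnegative sum. *)
Lemma sin_half_lower (u : R) : 0 <= u <= PI -> u / 6 <= sin (u / 2).
Proof.
intros Hu. pose proof PI_4 as HPI.
destruct (SIN (u / 2)) as [H _]; [lra|lra|].
apply Rle_trans with (2 := H).
unfold sin_lb, sin_approx, sum_f_R0, sin_term; simpl.
set (v := u / 2). replace (u / 6) with (v / 3) by (unfold v; field).
assert (Hv : 0 <= v <= 2) by (unfold v; lra).
assert (Hw : 0 <= v * v <= 4) by nra.
assert (Hq : 0 <= (v * v) * (v * v) * (1 / 120 - v * v / 5040)) by nra.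
assert (0 <= v * (2 / 3 - v * v / 6 + (v * v) * (v * v) * (1 / 120 - v * v / 5040))).
{ apply Rmult_le_pos; [lra|nra]. }
nra.
Qed.

(** Telescoping through [2 sin (u / 2) cos a = sin (a + u / 2) - sin (a - u / 2)]; the next lemma
    uses the same identity. *)
Lemma dirichlet_sum_shift (t u : R) (m : nat) :
  2 * sin (u / 2) * sumR m (fun k => cos ((t - INR k) * u))
  = sin ((t + / 2) * u) - sin ((t - INR m + / 2) * u).
Proof.
induction m as [|m IH]; [simpl; rewrite Rminus_0_r; ring|].
rewrite S_INR; simpl; rewrite Rmult_plus_distr_l, IH.
replace ((t - INR m + / 2) * u) with ((t - INR m) * u + u / 2) by field.
replace ((t - (INR m + 1) + / 2) * u) with ((t - INR m) * u - u / 2) by field.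
rewrite sin_plus, sin_minus; ring.
Qed.

Lemma dirichlet_kernel (u : R) (m : nat) :
  2 * sin (u / 2) * (/ 2 + sumR m (fun k => cos ((INR k + 1) * u))) = sin ((INR m + / 2) * u).
Proof.
induction m as [|m IH].
- simpl; replace ((0 + / 2) * u) with (u / 2) by field; field.
- rewrite S_INR; simpl; rewrite <- Rplus_assoc, Rmult_plus_distr_l, IH.
  replace ((INR m + / 2) * u) with ((INR m + 1) * u - u / 2) by field.
  replace ((INR m + 1 + / 2) * u) with ((INR m + 1) * u + u / 2) by field.
  rewrite sin_plus, sin_minus; ring.
Qed.

(* Chosen because its derivative in [u] is a sum of cosines with a closed form, while its value at
   [PI] is [sin (t * PI)] times the partial sum of the cosecant series. *)
Definition sin_sum (t : R) (n : nat) (u : R) : R :=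
  sumR (S n) (fun k => sin ((t - INR k) * u) / (t - INR k)).
(** Primitive, vanishing at 0, of half the Dirichlet kernel of order [m]. Its value at [PI] is
    [PI / 2] for every order. *)
Definition dirichlet_prim (m : nat) (u : R) : R :=
  u / 2 + sumR m (fun k => sin ((INR k + 1) * u) / (INR k + 1)).

Lemma is_derive_sin_scal (a u : R) :
  a <> 0 -> is_derive (fun v => sin (a * v) / a) u (cos (a * u)).
Proof. intros Ha; auto_derive; [easy|field; easy]. Qed.

(** The telescoped sum, written symmetrically under [t -> n - t]: two Dirichlet kernels of the
    possibly non-integral orders [t] and [n - t]. *)
Lemma is_derive_sin_sum (t : R) (n : nat) (u : R) :
  (forall k, (k <= n)%nat -> t <> INR k) -> sin (u / 2) <> 0 ->
  is_derive (sin_sum t n) u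
    ((sin ((t + / 2) * u) + sin ((INR n - t + / 2) * u)) / (2 * sin (u / 2))).
Proof.
intros Ht Hu.
replace (_ / _) with (sumR (S n) (fun k => cos ((t - INR k) * u))).
- apply (is_derive_sumR (S n) (fun k v => sin ((t - INR k) * v) / (t - INR k))
           (fun k v => cos ((t - INR k) * v))).
  intros k Hk; apply is_derive_sin_scal; specialize (Ht k ltac:(lia)); lra.
- apply (Rmult_eq_reg_l (2 * sin (u / 2))); [|lra].
  rewrite dirichlet_sum_shift, S_INR.
  replace ((t - (INR n + 1) + / 2) * u) with (- ((INR n - t + / 2) * u)) by field.
  rewrite sin_neg; field; exact Hu.
Qed.

Lemma is_derive_dirichlet_prim (m : nat) (u : R) :
  sin (u / 2) <> 0 ->
  is_derive (dirichlet_prim m) u (sin ((INR m + / 2) * u) / (2 * sin (u / 2))).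
Proof.
intros Hu.
replace (_ / _) with (/ 2 + sumR m (fun k => cos ((INR k + 1) * u))).
- apply (is_derive_plus (K := R_AbsRing) (V := R_NormedModule) (fun v => v / 2)).
  + auto_derive; [easy|field].
  + apply (is_derive_sumR m (fun k v => sin ((INR k + 1) * v) / (INR k + 1))
             (fun k v => cos ((INR k + 1) * v))).
    intros k _; apply is_derive_sin_scal; pose proof (pos_INR k); lra.
- rewrite <- (dirichlet_kernel u m); field; exact Hu.
Qed.

Lemma continuity_pt_sin_sum (t : R) (n : nat) (u : R) :
  (forall k, (k <= n)%nat -> t <> INR k) -> continuity_pt (sin_sum t n) u.
Proof.
intros Ht; apply continuity_pt_sumR with (F := fun k v => sin ((t - INR k) * v) / (t - INR k)).
intros k Hk; eapply is_derive_continuity_pt, is_derive_sin_scal; specialize (Ht k ltac:(lia)); lra.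
Qed.

Lemma continuity_pt_dirichlet_prim (m : nat) (u : R) : continuity_pt (dirichlet_prim m) u.
Proof.
apply (continuity_pt_plus (fun v => v / 2)).
- apply (is_derive_continuity_pt _ u (/ 2)); auto_derive; [easy|field].
- apply continuity_pt_sumR with (F := fun k v => sin ((INR k + 1) * v) / (INR k + 1)).
  intros k _; eapply is_derive_continuity_pt, is_derive_sin_scal; pose proof (pos_INR k); lra.
Qed.

Lemma sin_minus_INR_PI (a : R) (k : nat) : sin ((a - INR k) * PI) = (-1) ^ k * sin (a * PI).
Proof.
induction k as [|k IH]; [simpl; rewrite Rminus_0_r; ring|].
rewrite S_INR; simpl.
replace ((a - (INR k + 1)) * PI) with ((a - INR k) * PI - PI) by ring.
rewrite sin_minus, cos_PI, sin_PI, IH; ring.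
Qed.

Lemma sin_sum_PI (t : R) (n : nat) :
  sin_sum t n PI = sin (t * PI) * sumR (S n) (fun k => (-1) ^ k / (t - INR k)).
Proof.
unfold sin_sum; rewrite <- sumR_scal; apply sumR_ext; intros k _.
rewrite sin_minus_INR_PI; unfold Rdiv; ring.
Qed.

Lemma sin_sum_0 (t : R) (n : nat) : sin_sum t n 0 = 0.
Proof.
unfold sin_sum; rewrite (sumR_ext _ _ (fun _ => 0)); [rewrite sumR_const; ring|].
intros k _; rewrite Rmult_0_r, sin_0; unfold Rdiv; ring.
Qed.

Lemma dirichlet_prim_0 (m : nat) : dirichlet_prim m 0 = 0.
Proof.
unfold dirichlet_prim; rewrite (sumR_ext _ _ (fun _ => 0)); [rewrite sumR_const; field|].
intros k _; rewrite Rmult_0_r, sin_0; unfold Rdiv; ring.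
Qed.

Lemma dirichlet_prim_PI (m : nat) : dirichlet_prim m PI = PI / 2.
Proof.
unfold dirichlet_prim; rewrite (sumR_ext _ _ (fun _ => 0)); [rewrite sumR_const; field|].
intros k _; replace ((INR k + 1) * PI) with (- ((0 - INR (S k)) * PI)) by (rewrite S_INR; ring).
rewrite sin_neg, sin_minus_INR_PI, Rmult_0_l, sin_0; unfold Rdiv; ring.
Qed.

(** Amplitude of the oscillation left when a kernel of order [t] is compared with one of integral
    order [m], with [d = (t - m) / 2]. At [u = 0] the formula gives 0 instead of [2 d]; this is
    harmless because the function is multiplied there by a factor vanishing at 0. *)
Definition sin_ratio (d u : R) : R := sin (d * u) / sin (u / 2).
Definition sin_ratio' (d u : R) : R :=
  (d * cos (d * u) * sin (u / 2) - / 2 * sin (d * u) * cos (u / 2)) / (sin (u / 2)) ^ 2.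

Lemma is_derive_sin_ratio (d u : R) :
  sin (u / 2) <> 0 -> is_derive (sin_ratio d) u (sin_ratio' d u).
Proof.
intros H; unfold sin_ratio, sin_ratio'.
auto_derive; [exact H|]. unfold Rdiv; field; exact H.
Qed.

(** For [u > 0], the numerator is at most [u / 2] and the denominator at least [u / 6]; negative [u]
    follows by evenness. *)
Lemma Rabs_sin_ratio_le (d u : R) : 0 <= d <= / 2 -> Rabs u <= PI -> Rabs (sin_ratio d u) <= 3.
Proof.
intros Hd.
assert (H : forall v, 0 <= v <= PI -> Rabs (sin_ratio d v) <= 3).
{ intros v Hv; unfold sin_ratio.
  destruct (Req_dec v 0) as [->|Hv0].
  { rewrite Rmult_0_r, sin_0; unfold Rdiv; rewrite Rmult_0_l, Rabs_R0; lra. }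
  pose proof (sin_half_lower v Hv) as L.
  rewrite Rabs_div by lra; rewrite (Rabs_pos_eq (sin (v / 2))) by lra.
  apply Rle_div_l; [lra|].
  apply Rle_trans with (1 := Rabs_sin_le _).
  rewrite Rabs_pos_eq by nra; nra. }
intros Hu; destruct (Rle_dec 0 u) as [H0|H0].
- apply H; rewrite Rabs_pos_eq in Hu; lra.
- replace (sin_ratio d u) with (sin_ratio d (- u)).
  + apply H; rewrite Rabs_left in Hu; lra.
  + unfold sin_ratio.
    replace (d * - u) with (- (d * u)) by ring; replace (- u / 2) with (- (u / 2)) by field.
    rewrite !sin_neg; destruct (Req_dec (sin (u / 2)) 0) as [E|E].
    * rewrite E, Ropp_0; unfold Rdiv; rewrite Rinv_0; ring.
    * field; exact E.
Qed.

Lemma Rabs_sin_ratio'_le (d u : R) : 0 <= d <= / 2 -> 0 < u <= PI -> Rabs (sin_ratio' d u) <= 9.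
Proof.
intros Hd Hu; pose proof PI_4 as HPI.
pose proof (sin_half_lower u ltac:(lra)) as L.
(* The numerator vanishes at 0 and its derivative collapses to a product of two sines. *)
destruct (mean_value
  (fun v => d * cos (d * v) * sin (v / 2) - / 2 * sin (d * v) * cos (v / 2))
  (fun v => (/ 4 - d * d) * sin (d * v) * sin (v / 2)) 0 u) as [c [Hc E]].
- lra.
- intros c _; auto_derive; [easy|unfold Rdiv; field].
- intros c _; eapply is_derive_continuity_pt; auto_derive; [easy|reflexivity].
- replace (0 / 2) with 0 in E by field; rewrite !Rmult_0_r, sin_0 in E.
  unfold sin_ratio'; rewrite Rabs_div by (apply pow_nonzero; lra).
  rewrite (Rabs_pos_eq (sin (u / 2) ^ 2)) by (apply pow2_ge_0).
  apply Rle_div_l; [apply pow_lt; lra|].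
  replace (Rabs _) with (Rabs ((/ 4 - d * d) * sin (d * c) * sin (c / 2) * (u - 0)))
    by (rewrite <- E; f_equal; ring).
  rewrite !Rabs_mult.
  pose proof (Rabs_sin_le (d * c)) as H1; pose proof (Rabs_sin_le (c / 2)) as H2.
  rewrite (Rabs_pos_eq (d * c)) in H1 by nra; rewrite (Rabs_pos_eq (c / 2)) in H2 by lra.
  rewrite (Rabs_pos_eq (/ 4 - d * d)), (Rabs_pos_eq (u - 0)) by nra.
  assert (H3 : Rabs (sin (d * c)) * Rabs (sin (c / 2)) <= (u / 2) * (u / 2)).
  { apply Rmult_le_compat; try apply Rabs_pos; nra. }
  assert (H4 : 0 <= Rabs (sin (d * c)) * Rabs (sin (c / 2)))
    by (apply Rmult_le_pos; apply Rabs_pos).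
  assert (H5 : (u / 6) ^ 2 <= sin (u / 2) ^ 2) by (apply pow_incr; lra).
  (* As [u <= 4], the numerator is at most [u^2 / 4], and the denominator is at least [u^2 / 36];
     hence the constant 9. *)
  apply Rle_trans with (/ 4 * ((u / 2) * (u / 2)) * 4); [|nra].
  rewrite (Rmult_assoc (/ 4 - d * d)).
  set (p := Rabs (sin (d * c)) * Rabs (sin (c / 2))) in *.
  assert (0 <= d * d <= / 4) by nra.
  apply Rmult_le_compat; [apply Rmult_le_pos; lra|lra| |lra].
  apply Rmult_le_compat; lra.
Qed.

(** The primitives of the kernels of integral orders [m] and [n - m] contribute [PI / 2] each. The
    rest is an oscillatory integral with frequencies at least [t] and [n - t] and an amplitude that
    is bounded together with its derivative, so integration by parts gains the inverse
    frequencies. *)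
Lemma sin_sum_comparison (t : R) (n m : nat) :
  (forall k, (k <= n)%nat -> t <> INR k) -> (m <= n)%nat -> INR m <= t < INR m + 1 ->
  t < INR n ->
  Rabs (sin_sum t n PI - PI) <= 40 * (/ t + / (INR n - t)).
Proof.
intros Ht Hmn Hm Htn; pose proof PI_4 as HPI; pose proof PI_RGT_0 as HPI0.
pose proof (pos_INR m) as Hm0; pose proof (Ht O ltac:(lia)) as Ht0; simpl in Ht0.
(* [M1] is the mean of the frequencies [t + 1/2] and [m + 1/2], [M2] that of [n - t + 1/2] and
   [n - m + 1/2]; [d] is half the difference in both pairs. *)
set (d := (t - INR m) / 2); set (M1 := INR m + / 2 + d); set (M2 := INR (n - m) + / 2 - d).
assert (Hnm : INR (n - m) = INR n - INR m) by (apply minus_INR; lia).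
assert (Hd : 0 <= d <= / 2) by (unfold d; lra).
assert (HM1 : t <= M1) by (unfold M1, d; lra).
assert (HM2 : INR n - t <= M2) by (unfold M2, d; rewrite Hnm; lra).
(* The primitive of [cos (M1 u) - cos (M2 u)] that vanishes at 0. *)
set (w := fun u => sin (M1 * u) / M1 - sin (M2 * u) / M2).
set (B := / t + / (INR n - t)).
assert (I1 : / M1 <= / t) by (apply Rinv_le_contravar; lra).
assert (I2 : / M2 <= / (INR n - t)) by (apply Rinv_le_contravar; lra).
assert (P1 : 0 < / M1) by (apply Rinv_0_lt_compat; lra).
assert (P2 : 0 < / M2) by (apply Rinv_0_lt_compat; lra).
assert (Hw : forall u, Rabs (w u) <= B).
{ intros u; unfold w, B.
  apply Rle_trans with (/ M1 + / M2); [|lra].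
  apply Rabs_le; unfold Rdiv.
  pose proof (SIN_bound (M1 * u)); pose proof (SIN_bound (M2 * u)); nra. }
assert (Hw0 : forall u, Rabs (w u) <= 2 * Rabs u).
{ intros u; unfold w.
  assert (G : forall M, 0 < M -> Rabs (sin (M * u) / M) <= Rabs u).
  { intros M HM; rewrite Rabs_div, (Rabs_pos_eq M) by lra; apply Rle_div_l; [lra|].
    apply Rle_trans with (1 := Rabs_sin_le _).
    rewrite Rabs_mult, (Rabs_pos_eq M) by lra; lra. }
  pose proof (G M1 ltac:(lra)) as G1; pose proof (G M2 ltac:(lra)) as G2.
  revert G1 G2; unfold Rabs; repeat destruct Rcase_abs; lra. }
(* Integration by parts of the difference of the derivatives,
   [sin_ratio d u * (cos (M1 u) - cos (M2 u))], carried out through a primitive. *)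
set (Th := fun u => sin_sum t n u - dirichlet_prim m u - dirichlet_prim (n - m) u
                    - sin_ratio d u * w u).
assert (Hs : forall u, 0 < u <= PI -> sin (u / 2) <> 0).
{ intros u Hu; pose proof (sin_half_lower u); lra. }
assert (HD : forall u, 0 < u <= PI -> is_derive Th u (- sin_ratio' d u * w u)).
{ intros u Hu; specialize (Hs u Hu).
  assert (W : is_derive w u (cos (M1 * u) - cos (M2 * u))).
  { apply (is_derive_minus (K := R_AbsRing) (V := R_NormedModule));
      apply is_derive_sin_scal; lra. }
  pose proof (is_derive_mult _ _ u _ _ (is_derive_sin_ratio d u Hs) W Rmult_comm) as D1.
  pose proof (is_derive_minus (K := R_AbsRing) (V := R_NormedModule) _ _ u _ _
    (is_derive_minus (K := R_AbsRing) (V := R_NormedModule) _ _ u _ _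
    (is_derive_minus (K := R_AbsRing) (V := R_NormedModule) _ _ u _ _
      (is_derive_sin_sum t n u Ht Hs) (is_derive_dirichlet_prim m u Hs))
      (is_derive_dirichlet_prim (n - m) u Hs)) D1) as D2.
  eapply is_derive_ext_loc; [|evar_last; [exact D2|]].
  - apply filter_forall; intros v; reflexivity.
  - unfold minus, plus, opp, mult, sin_ratio; simpl; unfold mult; simpl.
    replace ((t + / 2) * u) with (M1 * u + d * u) by (unfold M1, d; field).
    replace ((INR n - t + / 2) * u) with (M2 * u - d * u)
      by (unfold M2, d; rewrite Hnm; field).
    replace ((INR m + / 2) * u) with (M1 * u - d * u) by (unfold M1; field).
    replace ((INR (n - m) + / 2) * u) with (M2 * u + d * u) by (unfold M2; field).
    rewrite !sin_plus, !sin_minus; field; exact Hs. }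
assert (HC : forall u, 0 <= u <= PI -> continuity_pt Th u).
{ intros u Hu; destruct (Req_dec u 0) as [->|Hu0].
  - unfold Th; apply continuity_pt_minus.
    + repeat apply continuity_pt_minus;
        auto using continuity_pt_sin_sum, continuity_pt_dirichlet_prim.
    (* Near 0 the product is at most [3 * (2 * Rabs v)], hence [eps / 6]. *)
    + intros eps Heps; exists (Rmin PI (eps / 6)); split; [apply Rmin_pos; lra|].
      intros v [_ Hv]; simpl in Hv |- *; unfold R_dist in *; rewrite Rminus_0_r in Hv.
      pose proof (Rmin_l PI (eps / 6)); pose proof (Rmin_r PI (eps / 6)).
      replace (w 0) with 0 by (unfold w; rewrite !Rmult_0_r, sin_0; unfold Rdiv; ring).
      rewrite Rmult_0_r, Rminus_0_r, Rabs_mult.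
      pose proof (Rabs_sin_ratio_le d v Hd ltac:(lra)); pose proof (Hw0 v).
      pose proof (Rabs_pos (sin_ratio d v)); pose proof (Rabs_pos (w v)); nra.
  - eapply is_derive_continuity_pt, HD; lra. }
destruct (mean_value Th (fun u => - sin_ratio' d u * w u) 0 PI) as [c [Hc E]]; auto.
{ intros c Hc; apply HD; lra. }
assert (HB : 0 <= B) by (apply Rle_trans with (2 := Hw 0), Rabs_pos).
assert (E0 : Th 0 = 0).
{ unfold Th; rewrite sin_sum_0, !dirichlet_prim_0; unfold w.
  rewrite !Rmult_0_r, sin_0; unfold Rdiv; ring. }
assert (E1 : sin_sum t n PI - PI
             = - sin_ratio' d c * w c * PI + sin_ratio d PI * w PI).
{ rewrite E0, !Rminus_0_r in E; rewrite <- E; unfold Th; rewrite !dirichlet_prim_PI; field. }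
(* The constant 40 covers [9 * PI + 3 <= 39]. *)
rewrite E1.
apply Rle_trans with (1 := Rabs_triang _ _).
rewrite !Rabs_mult, Rabs_Ropp, (Rabs_pos_eq PI) by lra.
pose proof (Rabs_sin_ratio'_le d c Hd ltac:(lra)) as K1.
pose proof (Rabs_sin_ratio_le d PI Hd ltac:(rewrite Rabs_pos_eq; lra)) as K2.
pose proof (Hw c) as K3; pose proof (Hw PI) as K4.
assert (Rabs (sin_ratio' d c) * Rabs (w c) <= 9 * B)
  by (apply Rmult_le_compat; auto; apply Rabs_pos).
assert (Rabs (sin_ratio d PI) * Rabs (w PI) <= 3 * B)
  by (apply Rmult_le_compat; auto; apply Rabs_pos).
assert (0 <= Rabs (sin_ratio' d c) * Rabs (w c)) by (apply Rmult_le_pos; apply Rabs_pos).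
nra.
Qed.

(** Quantitative truncation to [0 <= k <= n] of the expansion of [PI / sin (PI t)] as the sum of
    [(-1)^k / (t - k)] over all integers [k]. *)
Lemma alternating_cosecant_sum (t : R) (n : nat) :
  0 < t < INR n -> (forall k, (k <= n)%nat -> t <> INR k) ->
  Rabs (sin (t * PI) * sumR (S n) (fun k => (-1) ^ k / (t - INR k)) - PI)
  <= 40 * (/ t + / (INR n - t)).
Proof.
intros [Ht0 Htn] Ht; rewrite <- sin_sum_PI.
destruct (nfloor_ex t) as [m Hm]; [lra|].
apply sin_sum_comparison with m; auto.
apply INR_le; lra.
Qed.

(** * Alternating sums of difference quotients *)

(** Projection onto [[-1, 1]]. Composing with it replaces the arbitrary values of a total function
    outside the interval by constants, so that regularity up to the endpoints becomes continuity on
    the whole line. *)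
Definition clip (t : R) : R := Rmax (-1) (Rmin t 1).
Definition slope (f : R -> R) (x y : R) : R := (f y - f x) / (y - x).

Lemma clip_range (t : R) : -1 <= clip t <= 1.
Proof. unfold clip, Rmax, Rmin; repeat destruct Rle_dec; lra. Qed.

Lemma clip_id (t : R) : -1 <= t <= 1 -> clip t = t.
Proof. unfold clip, Rmax, Rmin; repeat destruct Rle_dec; lra. Qed.

Lemma clip_lipschitz (s t : R) : Rabs (clip s - clip t) <= Rabs (s - t).
Proof.
unfold clip, Rmax, Rmin, Rabs; repeat destruct Rle_dec; repeat destruct Rcase_abs; lra.
Qed.

Lemma continuity_clip (g : R -> R) :
  (forall p eps, -1 <= p <= 1 -> 0 < eps -> exists delta, 0 < delta /\
     forall t, -1 <= t <= 1 -> Rabs (t - p) < delta -> Rabs (g t - g p) < eps) ->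
  continuity (fun t => g (clip t)).
Proof.
intros H t eps Heps.
destruct (H (clip t) eps (clip_range t) Heps) as [d [Hd Hg]].
exists d; split; [exact Hd|]; intros s [_ Hs]; simpl in Hs |- *; unfold R_dist in *.
apply Hg; [apply clip_range|].
apply Rle_lt_trans with (1 := clip_lipschitz s t) (2 := Hs).
Qed.

Lemma abs_cont_continuity_clip (g : R -> R) :
  abs_cont_on g (-1) 1 -> continuity (fun t => g (clip t)).
Proof.
intros H; apply continuity_clip; intros p eps Hp Heps.
destruct (H eps Heps) as [d [Hd Hg]]; exists d; split; [exact Hd|]; intros t Ht Htp.
assert (G : forall a b, -1 <= a -> a <= b -> b <= 1 -> b - a < d -> Rabs (g b - g a) < eps).
{ intros a b Ha Hab Hb Hba.
  specialize (Hg 1%nat (fun _ => a) (fun _ => b)); simpl in Hg.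
  rewrite !Rplus_0_l in Hg; apply Hg; [auto|lia|lra]. }
destruct (Rle_dec p t) as [L|L].
- apply G; try lra; rewrite Rabs_pos_eq in Htp; lra.
- rewrite Rabs_minus_sym; apply G; try lra; rewrite Rabs_left in Htp; lra.
Qed.

Lemma filterlim_locally_bounded (F : (R -> Prop) -> Prop) (q : R -> R) (l : R) :
  filterlim q F (locally l) -> F (fun h => Rabs (q h) <= Rabs l + 1).
Proof.
intros H; apply (H (fun y => Rabs y <= Rabs l + 1)).
exists (mkposreal 1 Rlt_0_1); intros y Hy; change (Rabs (y - l) < 1) in Hy.
revert Hy; unfold Rabs; repeat destruct Rcase_abs; lra.
Qed.

(** At an endpoint the one-sided difference quotient is eventually bounded by some [C], which gives
    a local Lipschitz estimate and the radius [eps / C]. *)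
Lemma AC1_continuity_clip (f : R -> R) : AC1 f -> continuity (fun t => f (clip t)).
Proof.
intros (f' & HD & HL & HR & _); apply continuity_clip; intros p eps Hp Heps.
destruct (Req_dec p (-1)) as [->|Hp1]; [|destruct (Req_dec p 1) as [->|Hp2]].
- apply filterlim_locally_bounded in HL; destruct HL as [d Hd].
  set (C := Rabs (f' (-1)) + 1) in *.
  assert (HC : 1 <= C) by (unfold C; pose proof (Rabs_pos (f' (-1))); lra).
  exists (Rmin d (eps / C)); split.
  { apply Rmin_pos; [apply cond_pos|apply Rdiv_lt_0_compat; lra]. }
  intros t Ht Htp; destruct (Req_dec t (-1)) as [->|Ht1].
  { rewrite Rminus_diag, Rabs_R0; exact Heps. }
  pose proof (Rmin_l d (eps / C)); pose proof (Rmin_r d (eps / C)).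
  rewrite Rabs_pos_eq in Htp by lra.
  specialize (Hd (t - -1)); change (Rabs (t - -1 - 0) < d -> 0 < t - -1 ->
    Rabs ((f (-1 + (t - -1)) - f (-1)) / (t - -1)) <= C) in Hd.
  replace (-1 + (t - -1)) with t in Hd by ring.
  rewrite Rabs_div, (Rabs_pos_eq (t - -1)) in Hd by lra.
  specialize (Hd ltac:(rewrite Rabs_pos_eq; lra) ltac:(lra)).
  apply Rle_div_l in Hd; [|lra].
  apply Rle_lt_trans with (1 := Hd).
  apply Rlt_le_trans with (C * (eps / C)); [nra|right; field; lra].
- apply filterlim_locally_bounded in HR; destruct HR as [d Hd].
  set (C := Rabs (f' 1) + 1) in *.
  assert (HC : 1 <= C) by (unfold C; pose proof (Rabs_pos (f' 1)); lra).
  exists (Rmin d (eps / C)); split.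
  { apply Rmin_pos; [apply cond_pos|apply Rdiv_lt_0_compat; lra]. }
  intros t Ht Htp; destruct (Req_dec t 1) as [->|Ht1].
  { rewrite Rminus_diag, Rabs_R0; exact Heps. }
  pose proof (Rmin_l d (eps / C)); pose proof (Rmin_r d (eps / C)).
  rewrite Rabs_left in Htp by lra.
  specialize (Hd (t - 1)); change (Rabs (t - 1 - 0) < d -> t - 1 < 0 ->
    Rabs ((f (1 + (t - 1)) - f 1) / (t - 1)) <= C) in Hd.
  replace (1 + (t - 1)) with t in Hd by ring.
  rewrite Rabs_div, (Rabs_left (t - 1)) in Hd by lra.
  specialize (Hd ltac:(rewrite Rabs_left; lra) ltac:(lra)).
  apply Rle_div_l in Hd; [|lra].
  apply Rle_lt_trans with (1 := Hd).
  apply Rlt_le_trans with (C * (eps / C)); [nra|right; field; lra].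
- pose proof (is_derive_continuity_pt _ _ _ (HD p ltac:(lra))) as HC.
  destruct (HC eps Heps) as [d [Hd H]]; exists d; split; [exact Hd|].
  intros t _ Htp; destruct (Req_dec t p) as [->|Htp'].
  { rewrite Rminus_diag, Rabs_R0; exact Heps. }
  apply (H t); split; [split; [exact I|auto]|exact Htp].
Qed.

Lemma is_derive_clip (f f' : R -> R) (t : R) :
  -1 < t < 1 -> is_derive f t (f' t) -> is_derive (fun s => f (clip s)) t (f' t).
Proof.
intros Ht H; apply is_derive_ext_loc with (2 := H).
assert (Hd : 0 < Rmin (t + 1) (1 - t)) by (apply Rmin_pos; lra).
exists (mkposreal _ Hd); intros s Hs; change (Rabs (s - t) < Rmin (t + 1) (1 - t)) in Hs.
pose proof (Rmin_l (t + 1) (1 - t)); pose proof (Rmin_r (t + 1) (1 - t)).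
apply Rabs_lt_between in Hs; rewrite clip_id; lra.
Qed.

(* [slope f x y] is the mean of [f'] over [[x, y]]; the mean value theorem in the averaging
   parameter reduces its variation to that of [f'] on a homothetic copy of the points. *)
Lemma slope_variation (f f' : R -> R) (x : R) :
  -1 < x < 1 -> (forall t, -1 < t < 1 -> is_derive f t (f' t)) ->
  continuity (fun t => f (clip t)) -> abs_cont_on f' (-1) 1 ->
  forall eps, 0 < eps -> exists delta, 0 < delta /\
  forall (n : nat) (c : nat -> R),
    (forall k, -1 <= c k <= 1) -> (forall k, c k <> x) -> (forall k, c k <= c (S k)) ->
    c n - c O < delta ->
    sumR n (fun k => Rabs (slope f x (c (S k)) - slope f x (c k))) <= eps.
Proof.
intros Hx HD HC HA eps Heps; destruct (HA eps Heps) as [d [Hd H]].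
exists d; split; [exact Hd|]; intros n c Hr Hcx Hm Hn.
(* The signs remove the absolute values and make the sum an increment of the single function [phi],
   to which the mean value theorem applies. *)
set (sg := fun k => if Rle_dec 0 (slope f x (c (S k)) - slope f x (c k)) then 1 else -1).
set (h := fun k => c k - x).
assert (Hsg : forall k, Rabs (sg k) = 1).
{ intros k; unfold sg; destruct Rle_dec; [apply Rabs_R1|rewrite Rabs_left; lra]. }
(* [P k] is a primitive in [s] of [f' (x + s * h k)], and its increment from 0 to 1 is the slope at
   [c k]. *)
set (P := fun k s => f (clip (x + s * h k)) / h k).
set (phi := fun s => sumR n (fun k => sg k * (P (S k) s - P k s))).
set (dphi := fun s => sumR n (fun k => sg k * (f' (x + s * h (S k)) - f' (x + s * h k)))).
assert (Hin : forall k s, 0 < s < 1 -> -1 < x + s * h k < 1).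
{ intros k s Hs; unfold h; specialize (Hr k); nra. }
assert (HP : forall k s, 0 < s < 1 -> is_derive (P k) s (f' (x + s * h k))).
{ intros k s Hs; specialize (Hin k s Hs); specialize (Hcx k); unfold P.
  assert (D : is_derive (fun v => f (clip (x + v * h k))) s (h k * f' (x + s * h k))).
  { apply (is_derive_comp (fun v => f (clip v)) (fun v => x + v * h k)).
    - apply is_derive_clip; auto.
    - auto_derive; [easy|ring]. }
  apply (is_derive_scal _ _ (/ h k)) in D.
  eapply is_derive_ext; [|evar_last; [exact D|]].
  - intros v; simpl; unfold Rdiv; ring.
  - field; unfold h; lra. }
assert (HPc : forall k s, continuity_pt (P k) s).
{ intros k s; unfold P, Rdiv.
  apply (continuity_pt_mult (fun v => f (clip (x + v * h k))) (fun _ => / h k)).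
  - apply (continuity_pt_comp (fun v => x + v * h k) (fun v => f (clip v))).
    + apply (is_derive_continuity_pt _ _ (h k)); auto_derive; [easy|ring].
    + apply HC.
  - apply continuity_pt_const; intros a b; reflexivity. }
destruct (mean_value phi dphi 0 1) as [s [Hs E]].
- lra.
- intros s Hs.
  apply (is_derive_sumR n (fun k v => sg k * (P (S k) v - P k v))
    (fun k v => sg k * (f' (x + v * h (S k)) - f' (x + v * h k)))).
  intros k _; apply is_derive_scal.
  apply (is_derive_minus (K := R_AbsRing) (V := R_NormedModule)); auto.
- intros s _; apply (continuity_pt_sumR n (fun k v => sg k * (P (S k) v - P k v))).
  intros k _; apply (continuity_pt_mult (fun _ => sg k)).
  + apply continuity_pt_const; intros a b; reflexivity.
  + apply continuity_pt_minus; auto.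
- assert (Hsum : sumR n (fun k => Rabs (slope f x (c (S k)) - slope f x (c k))) = phi 1 - phi 0).
  { unfold phi; replace (sumR n _ - _) with
      (sumR n (fun k => sg k * (P (S k) 1 - P k 1)) + -1 * sumR n (fun k => sg k * (P (S k) 0 - P k 0)))
      by ring.
    rewrite <- sumR_scal, <- sumR_plus; apply sumR_ext; intros k _.
    assert (E1 : forall j, P j 1 - P j 0 = slope f x (c j)).
    { intros j; unfold P, h, slope; rewrite !clip_id.
      - replace (x + 1 * (c j - x)) with (c j) by ring.
        replace (x + 0 * (c j - x)) with x by ring.
        field; specialize (Hcx j); lra.
      - lra.
      - specialize (Hr j); lra. }
    replace (sg k * (P (S k) 1 - P k 1) + -1 * (sg k * (P (S k) 0 - P k 0)))
      with (sg k * ((P (S k) 1 - P (S k) 0) - (P k 1 - P k 0))) by ring.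
    rewrite !E1; unfold sg; destruct Rle_dec.
    - rewrite Rabs_pos_eq; lra.
    - rewrite Rabs_left; lra. }
  rewrite Hsum, E, Rminus_0_r, Rmult_1_r; left.
  apply Rle_lt_trans with (sumR n (fun k => Rabs (f' (x + s * h (S k)) - f' (x + s * h k)))).
  + apply sumR_le; intros k _.
    apply Rle_trans with (1 := Rle_abs _); rewrite Rabs_mult, Hsg; lra.
  + apply (H n (fun k => x + s * h k) (fun k => x + s * h (S k))).
    * intros k _; unfold h; pose proof (Hr k); pose proof (Hr (S k)); pose proof (Hm k).
      repeat split; nra.
    * intros k _; lra.
    * rewrite (sumR_telescope n (fun k => x + s * h k)); unfold h.
      assert (c O <= c n).
      { clear - Hm; induction n as [|n IH]; [lra|specialize (Hm n); lra]. }
      nra.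
Qed.

(** Away from [x] the slope is continuously differentiable up to the ends of [[p, q]]. Two
    applications of the mean value theorem turn the second difference into [h] times an increment of
    its derivative, which is uniformly continuous on [[p, q]]. *)
Lemma slope_second_difference (f f' : R -> R) (x p q : R) :
  (forall t, -1 < t < 1 -> is_derive f t (f' t)) ->
  continuity (fun t => f (clip t)) -> continuity (fun t => f' (clip t)) ->
  -1 <= x <= 1 -> -1 <= p -> q <= 1 -> (x < p \/ q < x) ->
  forall eps, 0 < eps -> exists delta, 0 < delta /\
  forall a h, 0 < h < delta -> p <= a -> a + 2 * h <= q ->
    Rabs (slope f x (a + 2 * h) - 2 * slope f x (a + h) + slope f x a) <= eps * h.
Proof.
intros HD HC HC' Hx Hp Hq Hpq eps Heps.
set (F := fun t => f (clip t)).
set (g := fun y => (F y - f x) / (y - x)).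
set (g' := fun y => (f' (clip y) * (y - x) - (F y - f x)) / (y - x) ^ 2).
assert (Ci : forall y, continuity_pt (fun v => v - x) y).
{ intros y; apply (is_derive_continuity_pt _ _ 1); auto_derive; [easy|ring]. }
assert (Cc : forall c y, continuity_pt (fun _ => c) y).
{ intros c y; apply continuity_pt_const; intros u v; reflexivity. }
assert (CF : forall y, continuity_pt (fun v => F v - f x) y).
{ intros y; apply (continuity_pt_minus F (fun _ => f x)); [apply HC|apply Cc]. }
assert (Cg : forall y, p <= y <= q -> continuity_pt g y).
{ intros y Hy; apply (continuity_pt_div (fun v => F v - f x) (fun v => v - x)); auto; lra. }
assert (Cg' : forall y, p <= y <= q -> continuity_pt g' y).
{ intros y Hy; apply (continuity_pt_div
    (fun v => f' (clip v) * (v - x) - (F v - f x)) (fun v => (v - x) ^ 2)).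
  - apply (continuity_pt_minus (fun v => f' (clip v) * (v - x)) (fun v => F v - f x)); [|auto].
    apply (continuity_pt_mult (fun v => f' (clip v)) (fun v => v - x)); [apply HC'|auto].
  - apply (is_derive_continuity_pt _ _ (2 * (y - x))); auto_derive; [easy|ring].
  - apply pow_nonzero; lra. }
assert (Dg : forall y, p < y < q -> is_derive g y (g' y)).
{ intros y Hy.
  assert (D : is_derive F y (f' y)) by (apply is_derive_clip; [lra|apply HD; lra]).
  unfold g, g'; rewrite (clip_id y) by lra.
  replace (f' y * (y - x) - (F y - f x)) with (f' y * (y - x) - (F y - f x) * 1) by ring.
  apply (is_derive_div (fun v => F v - f x) (fun v => v - x)).
  - replace (f' y) with (f' y - 0) by ring.
    apply (is_derive_minus (K := R_AbsRing) (V := R_NormedModule) F (fun _ => f x)); [exact D|].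
    apply (is_derive_const (K := R_AbsRing) (V := R_NormedModule)).
  - auto_derive; [easy|ring].
  - lra. }
destruct (Heine g' (fun c => p <= c <= q) (compact_P3 p q) Cg' (mkposreal eps Heps)) as [d Hd].
simpl in Hd; pose proof (cond_pos d) as Hd0.
(* The two intermediate points are less than [2 * h] apart. *)
exists (d / 2); split; [lra|]; intros a h Hh Ha Hah.
destruct (mean_value g g' a (a + h)) as [c1 [Hc1 E1]].
{ lra. }
{ intros c Hc; apply Dg; lra. }
{ intros c Hc; apply Cg; lra. }
destruct (mean_value g g' (a + h) (a + 2 * h)) as [c2 [Hc2 E2]].
{ lra. }
{ intros c Hc; apply Dg; lra. }
{ intros c Hc; apply Cg; lra. }
assert (S1 : forall y, p <= y <= q -> slope f x y = g y).
{ intros y Hy; unfold slope, g, F; rewrite clip_id by lra; reflexivity. }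
rewrite !S1 by lra.
replace (g (a + 2 * h) - 2 * g (a + h) + g a) with ((g' c2 - g' c1) * h) by lra.
rewrite Rabs_mult, (Rabs_pos_eq h) by lra.
apply Rmult_le_compat_r; [lra|]; left; apply Hd; try lra.
rewrite Rabs_pos_eq; lra.
Qed.

Lemma alternating_sum_by_parts (n : nat) (g : nat -> R) :
  2 * sumR (S n) (fun k => (-1) ^ k * g k)
  = g O + (-1) ^ n * g n + sumR n (fun k => (-1) ^ k * (g k - g (S k))).
Proof.
induction n as [|n IH]; [simpl; ring|].
change (sumR (S (S n)) (fun k => (-1) ^ k * g k))
  with (sumR (S n) (fun k => (-1) ^ k * g k) + (-1) ^ (S n) * g (S n)).
rewrite Rmult_plus_distr_l, IH; simpl; ring.
Qed.

(** Consecutive terms are paired from the end, hence the recursion by two; an odd number of terms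
    leaves [d 0] alone. Splitting the bound of a pair as [e k + e (S k)] lets each [e k] be counted
    once. *)
Lemma alternating_sum_pairs (n : nat) (d e : nat -> R) :
  (forall k, 0 <= e k) -> (forall k, (S k < n)%nat -> Rabs (d k - d (S k)) <= e k + e (S k)) ->
  Rabs (sumR n (fun k => (-1) ^ k * d k)) <= sumR n e + Rabs (d O).
Proof.
intros He; revert n.
fix IH 1; intros [|[|n]] H.
- simpl; rewrite Rabs_R0; pose proof (Rabs_pos (d O)); lra.
- simpl; rewrite Rplus_0_l, Rmult_1_l; specialize (He O); lra.
- specialize (IH n ltac:(intros k Hk; apply H; lia)).
  specialize (H n ltac:(lia)).
  replace (sumR (S (S n)) (fun k => (-1) ^ k * d k))
    with (sumR n (fun k => (-1) ^ k * d k) + (-1) ^ n * (d n - d (S n))) by (simpl; ring).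
  apply Rle_trans with (1 := Rabs_triang _ _).
  rewrite Rabs_mult, pow_1_abs; simpl; lra.
Qed.

(** * The numerator at the equispaced nodes *)

Lemma node_0 (n : nat) : node n 0 = -1.
Proof. unfold node; simpl; unfold Rdiv; ring. Qed.

Lemma node_last (n : nat) : (0 < n)%nat -> node n n = 1.
Proof. intros H; apply lt_0_INR in H; unfold node; field; lra. Qed.

Lemma node_S (n k : nat) : node n (S k) = node n k + 2 / INR n.
Proof. unfold node; rewrite S_INR; unfold Rdiv; ring. Qed.

Lemma node_range (n k : nat) : (0 < n)%nat -> (k <= n)%nat -> -1 <= node n k <= 1.
Proof.
intros Hn Hk; apply lt_0_INR in Hn; apply le_INR in Hk; pose proof (pos_INR k).
unfold node.
assert (0 <= 2 * INR k / INR n <= 2); [|lra].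
split; [apply Rdiv_le_0_compat; lra|apply Rle_div_l; lra].
Qed.

Lemma numerator_slope_sum (n : nat) (f : R -> R) (x : R) :
  ~ is_node n x ->
  Nb n f x - f x * Db n x = - sumR (S n) (fun k => (-1) ^ k * slope f x (node n k)).
Proof.
intros Hx; unfold Nb, Db.
replace (_ - _) with (sumR (S n) (fun k => (-1) ^ k * f (node n k) / (x - node n k))
  + - f x * sumR (S n) (fun k => (-1) ^ k / (x - node n k))) by ring.
replace (- sumR _ _) with (-1 * sumR (S n) (fun k => (-1) ^ k * slope f x (node n k))) by ring.
rewrite <- !sumR_scal, <- sumR_plus; apply sumR_ext; intros k Hk.
assert (x <> node n k) by (intros E; apply Hx; exists k; split; [lia|exact E]).
unfold slope; field; lra.
Qed.

(** Minus half the boundary terms of the summation by parts. The parameter [sgn] is the common value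
    of [(-1)^n] on a parity class, so both parities share one argument. *)
Definition numerator_limit (f : R -> R) (x sgn : R) : R :=
  - (slope f x (-1) + sgn * slope f x 1) / 2.

Lemma numerator_convergence (f : R -> R) (x : R) :
  AC1 f -> -1 < x < 1 -> forall eps, 0 < eps ->
  exists N, forall n, (N <= n)%nat -> ~ is_node n x ->
    Rabs (Nb n f x - f x * Db n x - numerator_limit f x ((-1) ^ n)) <= eps.
Proof.
intros HAC Hx eps Heps.
pose proof (AC1_continuity_clip f HAC) as HC.
destruct HAC as (f' & HD & _ & _ & HA).
pose proof (abs_cont_continuity_clip f' HA) as HC'.
(* The alternating sum of increments will cost [4 * e]: variation near [x] gives [e], second
   differences give [n * e * h = 2 * e], and the unpaired first increment gives [e]. Summation by
   parts halves this. *)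
set (e := eps / 2); assert (He : 0 < e) by (unfold e; lra).
destruct (slope_variation f f' x Hx HD HC HA e He) as [d1 [Hd1 V]].
(* The window of radius [2 * eta] around [x] stays inside [(-1, 1)], and its length [4 * eta] is
   below [d1]. *)
set (eta := Rmin (d1 / 8) (Rmin ((1 + x) / 4) ((1 - x) / 4))).
assert (Heta : 0 < eta) by (unfold eta; repeat apply Rmin_pos; lra).
assert (Heta1 : eta <= d1 / 8) by apply Rmin_l.
assert (Heta2 : eta <= (1 + x) / 4)
  by (apply Rle_trans with (1 := Rmin_r _ _), Rmin_l).
assert (Heta3 : eta <= (1 - x) / 4)
  by (apply Rle_trans with (1 := Rmin_r _ _), Rmin_r).
destruct (slope_second_difference f f' x (x + eta) 1 HD HC HC') with (eps := e)
  as [d2 [Hd2 W2]]; try lra.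
destruct (slope_second_difference f f' x (-1) (x - eta) HD HC HC') with (eps := e)
  as [d3 [Hd3 W3]]; try lra.
assert (HS : continuity_pt (fun y => (f (clip y) - f x) / (y - x)) (-1)).
{ apply (continuity_pt_div (fun y => f (clip y) - f x) (fun y => y - x)); [| |lra].
  - apply (continuity_pt_minus (fun y => f (clip y)) (fun _ => f x)); [apply HC|].
    apply continuity_pt_const; intros u v; reflexivity.
  - apply (is_derive_continuity_pt _ _ 1); auto_derive; [easy|ring]. }
destruct (HS e He) as [d4 [Hd4 W4]].
set (d := Rmin (Rmin d2 d3) (Rmin d4 (eta / 2))).
assert (Hd : 0 < d) by (unfold d; repeat apply Rmin_pos; lra).
assert (B1 : d <= d2) by (apply Rle_trans with (1 := Rmin_l _ _), Rmin_l).
assert (B2 : d <= d3) by (apply Rle_trans with (1 := Rmin_l _ _), Rmin_r).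
assert (B3 : d <= d4) by (apply Rle_trans with (1 := Rmin_r _ _), Rmin_l).
assert (B4 : d <= eta / 2) by (apply Rle_trans with (1 := Rmin_r _ _), Rmin_r).
destruct (nfloor_ex (2 / d)) as [N HN]; [apply Rdiv_le_0_compat; lra|].
exists (S N); intros n Hn Hnx.
assert (Hn0 : (0 < n)%nat) by lia.
assert (HnR : 0 < INR n) by (apply lt_0_INR; exact Hn0).
set (h := 2 / INR n).
assert (Hh : 0 < h < d).
{ unfold h; split; [apply Rdiv_lt_0_compat; lra|].
  apply le_INR in Hn; rewrite S_INR in Hn.
  apply Rlt_div_l; [lra|].
  assert (2 / d < INR n) by lra.
  apply Rlt_div_l in H; lra. }
assert (Hnode : forall k, (k <= n)%nat -> node n k <> x).
{ intros k Hk E; apply Hnx; exists k; auto. }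
(* Clamping the nodes to a neighbourhood of [x] isolates the variation of the slope there. *)
set (c := fun k => Rmax (x - 2 * eta) (Rmin (node n k) (x + 2 * eta))).
(* [slope_variation] asks for its conditions at every index, whereas [x] is known to avoid only the
   nodes of index at most [n]. *)
set (c' := fun k => c (Nat.min k n)).
assert (Hc'n : forall k, (k <= n)%nat -> c' k = c k).
{ intros k Hk; unfold c'; rewrite Nat.min_l; auto. }
assert (Vc : sumR n (fun k => Rabs (slope f x (c (S k)) - slope f x (c k))) <= e).
{ rewrite (sumR_ext n _ (fun k => Rabs (slope f x (c' (S k)) - slope f x (c' k)))).
  2: { intros k Hk; rewrite !Hc'n by lia; reflexivity. }
  apply V.
  - intros k; unfold c', c, Rmax, Rmin; repeat destruct Rle_dec; lra.
  - intros k; specialize (Hnode (Nat.min k n) ltac:(lia)).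
    unfold c', c, Rmax, Rmin; repeat destruct Rle_dec; lra.
  - intros k.
    assert (node n (Nat.min k n) <= node n (Nat.min (S k) n)).
    { destruct (Nat.le_gt_cases n k).
      - rewrite !Nat.min_r by lia; lra.
      - rewrite !Nat.min_l by lia; rewrite node_S; fold h; lra. }
    unfold c', c, Rmax, Rmin; repeat destruct Rle_dec; lra.
  - unfold c', c, Rmax, Rmin; repeat destruct Rle_dec; lra. }
set (g := fun k => slope f x (node n k)).
assert (Alt : Rabs (sumR n (fun k => (-1) ^ k * (g k - g (S k)))) <= 4 * e).
{ apply Rle_trans with (sumR n (fun k => Rabs (slope f x (c (S k)) - slope f x (c k)) + e * h)
    + Rabs (g O - g 1%nat)).
  - apply (alternating_sum_pairs n (fun k => g k - g (S k))).
    + intros k; pose proof (Rabs_pos (slope f x (c (S k)) - slope f x (c k))).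
      assert (0 < e * h) by (apply Rmult_lt_0_compat; lra); lra.
    + intros k Hk.
      pose proof (node_range n k Hn0 ltac:(lia)) as R0.
      pose proof (node_range n (S (S k)) Hn0 ltac:(lia)) as R2.
      assert (T1 : node n (S k) = node n k + h) by apply node_S.
      assert (T2 : node n (S (S k)) = node n k + 2 * h) by (rewrite !node_S; fold h; ring).
      assert (0 < e * h) by (apply Rmult_lt_0_compat; lra).
      pose proof (Rabs_pos (slope f x (c (S k)) - slope f x (c k))).
      pose proof (Rabs_pos (slope f x (c (S (S k))) - slope f x (c (S k)))).
      replace (g k - g (S k) - (g (S k) - g (S (S k))))
        with (slope f x (node n k + 2 * h) - 2 * slope f x (node n k + h) + slope f x (node n k))
        by (unfold g; rewrite T1, T2; ring).
      (* Three consecutive nodes lie all to the right of [x + eta], or all to the left of [x - eta],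
         or, since [2 * h < eta], all within [2 * eta] of [x], where clamping changes nothing. *)
      destruct (Rle_dec (x + eta) (node n k)) as [F1|F1].
      { specialize (W2 (node n k) h ltac:(lra) F1 ltac:(lra)); lra. }
      destruct (Rle_dec (node n (S (S k))) (x - eta)) as [F2|F2].
      { specialize (W3 (node n k) h ltac:(lra) ltac:(lra) ltac:(lra)); lra. }
      assert (C : forall j, x - 2 * eta <= node n j <= x + 2 * eta -> c j = node n j).
      { intros j Hj; unfold c, Rmax, Rmin; repeat destruct Rle_dec; lra. }
      revert H0 H1; rewrite !C by lra; rewrite T1, T2.
      unfold Rabs; repeat destruct Rcase_abs; lra.
  - rewrite sumR_plus, sumR_const.
    replace (INR n * (e * h)) with (2 * e) by (unfold h; field; lra).
    assert (Rabs (g O - g 1%nat) < e); [|lra].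
    rewrite Rabs_minus_sym; unfold g; rewrite node_S, node_0; fold h.
    specialize (W4 (-1 + h)); simpl in W4; unfold R_dist in W4.
    rewrite !clip_id in W4 by lra; apply W4.
    split; [split; [exact I|lra]|rewrite Rabs_pos_eq; lra]. }
rewrite (numerator_slope_sum n f x Hnx); fold g.
pose proof (alternating_sum_by_parts n g) as Hparts.
replace (_ - _) with (- (sumR n (fun k => (-1) ^ k * (g k - g (S k))) / 2)).
- rewrite Rabs_Ropp, Rabs_div, (Rabs_pos_eq 2) by lra; unfold e in Alt; lra.
- unfold numerator_limit.
  replace (slope f x (-1)) with (g O) by (unfold g; rewrite node_0; reflexivity).
  replace (slope f x 1) with (g n) by (unfold g; rewrite node_last; auto).
  change (fun k => (-1) ^ k * slope f x (node n k)) with (fun k => (-1) ^ k * g k); lra.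
Qed.

(** * The denominator *)

(** The real index of [x] in the numbering of the nodes: [x - node n k] is [2 / n] times
    [phase x n - k]. *)
Definition phase (x : R) (n : nat) : R := INR n * ((x + 1) / 2).
Definition phase_sin (x : R) (n : nat) : R := sin (phase x n * PI).

Lemma Db_phase (n : nat) (x : R) :
  (0 < n)%nat -> ~ is_node n x ->
  Db n x / INR n = / 2 * sumR (S n) (fun k => (-1) ^ k / (phase x n - INR k)).
Proof.
intros Hn Hx; apply lt_0_INR in Hn; unfold Db, Rdiv at 1.
rewrite Rmult_comm, <- !sumR_scal; apply sumR_ext; intros k Hk.
assert (E : x - node n k <> 0).
{ intros E; apply Hx; exists k; split; [lia|lra]. }
assert (E' : x - node n k = 2 * (phase x n - INR k) / INR n) by (unfold node, phase; field; lra).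
rewrite E' in *; field; repeat split; try lra.
intros E''; apply E; rewrite E''; field; lra.
Qed.

Lemma phase_not_node (n k : nat) (x : R) :
  (0 < n)%nat -> (k <= n)%nat -> ~ is_node n x -> phase x n <> INR k.
Proof.
intros Hn Hk Hx E; apply Hx; exists k; split; [exact Hk|].
apply lt_0_INR in Hn; unfold node; rewrite <- E; unfold phase; field; lra.
Qed.

Lemma phase_range (x : R) (n : nat) :
  -1 < x < 1 -> (0 < n)%nat -> 0 < phase x n < INR n.
Proof.
intros Hx Hn; apply lt_0_INR in Hn; unfold phase; split; [apply Rmult_lt_0_compat; lra|].
rewrite <- (Rmult_1_r (INR n)) at 2; apply Rmult_lt_compat_l; lra.
Qed.

Lemma denominator_convergence (x : R) :
  -1 < x < 1 -> forall eps, 0 < eps ->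
  exists N, forall n, (N <= n)%nat -> ~ is_node n x ->
    Rabs (phase_sin x n * (Db n x / INR n) - PI / 2) <= eps.
Proof.
(* With [t = n (1 + x) / 2], half of [40 * (/ t + / (n - t))] equals [K / n]. *)
intros Hx eps Heps; set (K := 40 / (1 + x) + 40 / (1 - x)).
assert (HK : 0 < K).
{ unfold K; apply Rplus_lt_0_compat; apply Rdiv_lt_0_compat; lra. }
destruct (nfloor_ex (K / eps)) as [N HN]; [apply Rdiv_le_0_compat; lra|].
exists (S N); intros n Hn Hnx.
assert (Hn0 : (0 < n)%nat) by lia.
apply le_INR in Hn; rewrite S_INR in Hn; pose proof (lt_0_INR n Hn0) as HnR.
rewrite Db_phase by auto.
replace (_ - _) with (/ 2 * (sin (phase x n * PI)
   * sumR (S n) (fun k => (-1) ^ k / (phase x n - INR k)) - PI)) by (unfold phase_sin; field).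
rewrite Rabs_mult, Rabs_pos_eq by lra.
pose proof (phase_range x n Hx ltac:(assumption)) as H.
pose proof (alternating_cosecant_sum (phase x n) n H
  ltac:(intros k Hk; apply phase_not_node; auto)) as B.
replace (INR n - phase x n) with (INR n * ((1 - x) / 2)) in B by (unfold phase; field).
unfold phase in B at 3.
replace (40 * _) with (2 * (K / INR n)) in B by (unfold K; field; repeat split; lra).
assert (K / INR n <= eps); [|lra].
apply Rle_div_l; [lra|].
assert (K / eps < INR n) by lra.
apply Rlt_div_l in H0; lra.
Qed.

(** A zero of the sine makes the phase an integer, and its position between 0 and [n] makes this
    integer the index of a node. *)
Lemma phase_sin_neq_0 (x : R) (n : nat) :
  -1 < x < 1 -> (0 < n)%nat -> ~ is_node n x -> phase_sin x n <> 0.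
Proof.
intros Hx Hn Hnx E; unfold phase_sin in E.
pose proof (lt_0_INR n Hn) as HnR.
pose proof (phase_range x n Hx ltac:(assumption)) as H.
destruct (sin_eq_0_0 _ E) as [k Hk].
apply Rmult_eq_reg_r in Hk; [|apply PI_neq0].
assert (Hk0 : (0 <= k)%Z) by (apply le_IZR; lra).
rewrite <- (Z2Nat.id k Hk0), <- INR_IZR_INZ in Hk.
apply (phase_not_node n (Z.to_nat k) x Hn); auto.
apply INR_le; lra.
Qed.

(** * Periodicity and density of the phase *)

Lemma is_lim_seq_eps (u : nat -> R) (l : R) :
  (forall eps, 0 < eps -> exists N, forall n, (N <= n)%nat -> Rabs (u n - l) <= eps) ->
  is_lim_seq u l.
Proof.
intros H; apply is_lim_seq_spec; intros eps.
pose proof (cond_pos eps); destruct (H (eps / 2) ltac:(lra)) as [N HN].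
exists N; intros n Hn; specialize (HN n Hn); lra.
Qed.

Lemma strictly_incr_ge (n : nat -> nat) : strictly_incr n -> forall j, (j <= n j)%nat.
Proof.
intros H; induction j as [|j IH]; [lia|].
specialize (H j (S j) ltac:(lia)); lia.
Qed.

Lemma strictly_incr_succ (n : nat -> nat) :
  (forall j, (n j < n (S j))%nat) -> strictly_incr n.
Proof.
intros H i j Hij; induction Hij as [|j _ IH]; [apply H|]; specialize (H j); lia.
Qed.

Lemma is_lim_seq_strictly_incr (u : nat -> R) (l : Rbar) (n : nat -> nat) :
  strictly_incr n -> is_lim_seq u l -> is_lim_seq (fun j => u (n j)) l.
Proof.
intros Hn; apply is_lim_seq_subseq, eventually_subseq; intros j; apply Hn; lia.
Qed.

(** The dependence of [T] on [j] allows tolerances that shrink along the sequence; a constant [T]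
    extracts a subsequence on which a recurring event always happens. *)
Lemma strictly_incr_choice (T : nat -> nat -> Prop) :
  (forall j N, exists n, (N <= n)%nat /\ T j n) ->
  exists phi, strictly_incr phi /\ forall j, T j (phi j).
Proof.
intros H.
set (pick := fun j N => proj1_sig (constructive_indefinite_description _ (H j N))).
assert (Hpick : forall j N, (N <= pick j N)%nat /\ T j (pick j N)).
{ intros j N; exact (proj2_sig (constructive_indefinite_description _ (H j N))). }
set (phi := fix phi j := match j with O => pick O O | S i => pick (S i) (S (phi i)) end).
exists phi; split.
- apply strictly_incr_succ; intros j; simpl.
  destruct (Hpick (S j) (S (phi j))); lia.
- intros [|j]; simpl; apply Hpick.
Qed.

(** The threshold [j0] serves the induction: if the last colour recurs only finitely often, one
    colour fewer remains beyond some index. *)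
Lemma pigeonhole_infinite (Q : nat) (c : nat -> nat) (j0 : nat) :
  (forall j, (j0 <= j)%nat -> (c j < Q)%nat) ->
  exists r, (r < Q)%nat /\ forall N, exists j, (N <= j)%nat /\ c j = r.
Proof.
revert j0; induction Q as [|Q IH]; intros j0 H; [specialize (H j0); lia|].
destruct (classic (forall N, exists j, (N <= j)%nat /\ c j = Q)) as [HQ|HQ].
- exists Q; split; [lia|exact HQ].
- apply not_all_ex_not in HQ; destruct HQ as [N HN].
  destruct (IH (Nat.max j0 N)) as [r [Hr Hinf]].
  + intros j Hj; specialize (H j ltac:(lia)).
    assert (c j <> Q); [|lia].
    intros E; apply HN; exists j; split; [lia|exact E].
  + exists r; split; [lia|exact Hinf].
Qed.

Lemma rational_period (x : R) :
  rational x -> -1 < x ->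
  exists Q K : nat, (0 < Q)%nat /\ INR Q * ((x + 1) / 2) = 2 * INR K.
Proof.
intros (p & q & Hq & ->) Hx.
assert (HqR : IZR q <> 0) by (apply not_0_IZR; exact Hq).
(* Adding [2 |q|] to [n] already shifts the phase by an integer; doubling makes the shift even, so
   that the sine is unchanged, sign included. *)
exists (4 * Z.abs_nat q)%nat, (Z.to_nat (Z.sgn q * (p + q))).
assert (HA : IZR (Z.abs q) = IZR (Z.sgn q) * IZR q) by (rewrite <- mult_IZR; f_equal; lia).
assert (E : IZR (Z.abs q) * (IZR p / IZR q + 1) = IZR (Z.sgn q * (p + q))).
{ rewrite HA, mult_IZR, plus_IZR; field; exact HqR. }
split; [lia|].
rewrite mult_INR, !INR_IZR_INZ, Nat2Z.inj_abs_nat, Z2Nat.id.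
- rewrite <- E; simpl; field; exact HqR.
- apply le_IZR; rewrite <- E; apply Rmult_le_pos; [apply IZR_le; lia|lra].
Qed.

Lemma phase_sin_mod (x : R) (Q K : nat) :
  INR Q * ((x + 1) / 2) = 2 * INR K ->
  forall n, phase_sin x n = phase_sin x (n mod Q).
Proof.
intros H n; unfold phase_sin, phase.
rewrite (Nat.div_mod_eq n Q) at 1.
rewrite plus_INR, mult_INR, <- (sin_period (INR (n mod Q) * ((x + 1) / 2) * PI) (n / Q * K)), mult_INR.
f_equal.
replace ((INR Q * INR (n / Q) + INR (n mod Q)) * ((x + 1) / 2))
  with (INR Q * ((x + 1) / 2) * INR (n / Q) + INR (n mod Q) * ((x + 1) / 2)) by ring.
rewrite H; ring.
Qed.

Lemma irrational_multiple (alpha : R) (a k : Z) :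
  irrational alpha -> a <> 0%Z -> IZR a * alpha - IZR k <> 0.
Proof.
intros H Ha E; apply H; exists k, a; split; [exact Ha|].
apply not_0_IZR in Ha; replace (IZR k) with (IZR a * alpha) by lra; field; exact Ha.
Qed.

(* Euclid's algorithm: dividing 1 by [|a alpha - k|] with centred remainder halves it. *)
Lemma small_multiple_mod_1 (alpha : R) :
  irrational alpha -> forall i, exists a k : Z, (0 < a)%Z /\
    0 < Rabs (IZR a * alpha - IZR k) <= (/ 2) ^ i.
Proof.
intros Halpha.
assert (G : forall i, exists a k : Z, (0 < a)%Z /\ Rabs (IZR a * alpha - IZR k) <= (/ 2) ^ i).
{ induction i as [|i (a & k & Ha & Hi)].
  - exists 1%Z, (Int_part alpha); split; [lia|].
    destruct (base_Int_part alpha); simpl; apply Rabs_le; lra.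
  - set (eta := IZR a * alpha - IZR k) in *.
    assert (Heta : 0 < Rabs eta)
      by (apply Rabs_pos_lt, irrational_multiple; [exact Halpha|lia]).
    set (q := Int_part (/ Rabs eta)).
    destruct (base_Int_part (/ Rabs eta)) as [Q1 Q2]; fold q in Q1, Q2.
    assert (H1 : / Rabs eta * Rabs eta = 1) by (field; lra).
    assert (R1 : IZR q * Rabs eta <= 1) by nra.
    assert (R2 : 1 < (IZR q + 1) * Rabs eta) by nra.
    (* As [Rabs eta <= 1], the quotient [q] is positive, which keeps the new multiplier positive. *)
    assert (Rlt1 : (/ 2) ^ i <= 1) by (rewrite <- (pow1 i); apply pow_incr; lra).
    assert (Hq : (0 < q)%Z).
    { assert (-1 + 1 < IZR q) by nra. apply lt_IZR; lra. }
    assert (Hsg : exists s : Z, Rabs eta = IZR s * eta /\ (s = 1 \/ s = -1)%Z).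
    { destruct (Rle_dec 0 eta).
      - exists 1%Z; rewrite Rabs_pos_eq; [split; [ring|auto]|easy].
      - exists (-1)%Z; rewrite Rabs_left; [split; [ring|auto]|lra]. }
    destruct Hsg as [s [Es Hs]].
    assert (Ess : IZR s * IZR s = 1) by (destruct Hs as [-> | ->]; ring).
    assert (As : Rabs (IZR s) = 1)
      by (destruct Hs as [-> | ->]; [apply Rabs_R1|rewrite Rabs_left; lra]).
    (* If [r * Rabs eta] is close to 1, then [r * a] is a better multiplier: the 1, with the sign
       [s] of [eta], is absorbed into the integer part. *)
    assert (B : forall r, Rabs (IZR r * Rabs eta - 1) <= Rabs eta / 2 ->
      Rabs (IZR (r * a) * alpha - IZR (r * k + s)) <= (/ 2) ^ (S i)).
    { intros r Hr; rewrite plus_IZR, !mult_IZR.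
      replace (IZR r * IZR a * alpha - (IZR r * IZR k + IZR s))
        with (IZR s * (IZR r * Rabs eta - 1)).
      - rewrite Rabs_mult, As; simpl; lra.
      - rewrite Es.
        replace (IZR s * (IZR r * (IZR s * eta) - 1))
          with (IZR s * IZR s * IZR r * eta - IZR s) by ring.
        rewrite Ess; unfold eta; ring. }
    destruct (Rle_dec (1 - IZR q * Rabs eta) (Rabs eta / 2)) as [C|C].
    + exists (q * a)%Z, (q * k + s)%Z; split; [nia|apply B].
      rewrite Rabs_left1; lra.
    + exists ((q + 1) * a)%Z, ((q + 1) * k + s)%Z; split; [nia|apply B].
      rewrite plus_IZR, Rabs_pos_eq; lra. }
intros i; destruct (G i) as (a & k & Ha & Hi); exists a, k; repeat split; auto.
apply Rabs_pos_lt, irrational_multiple; [exact Halpha|lia].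
Qed.

(** Starting from [N * alpha], adding [a] to the multiplier moves the point by [eta] modulo 1. Such
    equal steps, each shorter than [eps], come within one step of any target. *)
Lemma multiples_dense_mod_1 (alpha beta : R) (N : nat) (eps : R) :
  irrational alpha -> 0 < eps ->
  exists (m : nat) (z : Z), (N <= m)%nat /\ Rabs (INR m * alpha - IZR z - beta) < eps.
Proof.
intros Halpha Heps.
destruct (pow_lt_1_zero (/ 2) ltac:(rewrite Rabs_pos_eq; lra) eps Heps) as [i Hi].
destruct (small_multiple_mod_1 alpha Halpha i) as (a & k & Ha & Hk0 & Hk).
specialize (Hi i (le_n i)); pose proof (Rle_abs ((/ 2) ^ i)) as Hii.
set (eta := IZR a * alpha - IZR k) in *.
assert (Heta : eta <> 0) by (intros E; rewrite E, Rabs_R0 in Hk0; lra).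
set (b := beta - INR N * alpha).
(* An integer translate of the target is chosen on the side towards which the steps move, so that
   their number is nonnegative. *)
assert (Hz : exists z0 : Z, 0 <= (b + IZR z0) / eta).
{ destruct (Rle_dec 0 eta).
  - exists (up (- b)); destruct (archimed (- b)); apply Rdiv_le_0_compat; lra.
  - exists (- up b)%Z; destruct (archimed b); rewrite opp_IZR.
    replace ((b + - IZR (up b)) / eta) with ((IZR (up b) - b) / (- eta)) by (field; lra).
    apply Rdiv_le_0_compat; lra. }
destruct Hz as [z0 Hz0].
destruct (nfloor_ex _ Hz0) as [j Hj].
exists (N + j * Z.to_nat a)%nat, (Z.of_nat j * k + z0)%Z; split; [lia|].
rewrite plus_INR, mult_INR, plus_IZR, mult_IZR, <- INR_IZR_INZ, (INR_IZR_INZ (Z.to_nat a)),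
  Z2Nat.id by lia.
replace (_ - beta) with ((INR j - (b + IZR z0) / eta) * eta)
  by (unfold b; replace (IZR a * alpha) with (eta + IZR k) by (unfold eta; ring);
      unfold eta in *; field; exact Heta).
rewrite Rabs_mult.
assert (Rabs (INR j - (b + IZR z0) / eta) <= 1) by (apply Rabs_le; lra).
pose proof (Rabs_pos (INR j - (b + IZR z0) / eta)); nra.
Qed.

Lemma sin_period_Z (y : R) (z : Z) : sin (y + 2 * IZR z * PI) = sin y.
Proof.
destruct (Z.le_gt_cases 0 z) as [Hz|Hz].
- rewrite <- (Z2Nat.id z Hz), <- INR_IZR_INZ; apply sin_period.
- rewrite <- (sin_period (y + 2 * IZR z * PI) (Z.to_nat (- z))).
  rewrite INR_IZR_INZ, Z2Nat.id, opp_IZR by lia; f_equal; ring.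
Qed.

Lemma Rabs_sin_minus_le (a b : R) : Rabs (sin a - sin b) <= Rabs (a - b).
Proof.
rewrite form4, !Rabs_mult, (Rabs_pos_eq 2) by lra.
pose proof (Rabs_sin_le ((a - b) / 2)) as H.
rewrite (Rabs_div (a - b)), (Rabs_pos_eq 2) in H by lra.
assert (Rabs (cos ((a + b) / 2)) <= 1) by (apply Rabs_le; apply COS_bound).
pose proof (Rabs_pos (cos ((a + b) / 2))); pose proof (Rabs_pos (sin ((a - b) / 2))); nra.
Qed.

(** For [n = 2 m + b] the angle is [2 PI m alpha + b alpha PI], so its class modulo [2 PI] depends
    on [m] only through [m * alpha] modulo 1. *)
Lemma phase_sin_dense (x sigma : R) (b N : nat) (eps : R) :
  irrational x -> -1 <= sigma <= 1 -> 0 < eps ->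
  exists m, (N <= m)%nat /\ Rabs (phase_sin x (2 * m + b) - sigma) < eps.
Proof.
intros Hx Hs Heps; pose proof PI_RGT_0 as HPI.
set (alpha := (x + 1) / 2).
assert (Halpha : irrational alpha).
{ intros (p & q & Hq & E); apply Hx; exists (2 * p - q)%Z, q; split; [exact Hq|].
  apply not_0_IZR in Hq; rewrite minus_IZR, mult_IZR.
  replace x with (2 * alpha - 1) by (unfold alpha; field); rewrite E; field; exact Hq. }
destruct (multiples_dense_mod_1 alpha ((asin sigma - INR b * alpha * PI) / (2 * PI)) N
  (eps / (2 * PI)) Halpha) as (m & z & Hm & H).
{ apply Rdiv_lt_0_compat; lra. }
exists m; split; [exact Hm|].
rewrite <- (sin_asin sigma Hs) at 1; unfold phase_sin.
rewrite <- (sin_period_Z (asin sigma) z).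
apply Rle_lt_trans with (1 := Rabs_sin_minus_le _ _).
replace (_ - _) with
  ((INR m * alpha - IZR z - (asin sigma - INR b * alpha * PI) / (2 * PI)) * (2 * PI)).
- rewrite Rabs_mult, (Rabs_pos_eq (2 * PI)) by lra.
  apply Rlt_div_r in H; lra.
- unfold phase; rewrite plus_INR, mult_INR; fold alpha; simpl; field; lra.
Qed.

(** * Limits of the scaled error *)

Lemma irrational_interior (x : R) : irrational x -> -1 <= x <= 1 -> -1 < x < 1.
Proof.
intros H Hx.
assert (x <> -1).
{ intros ->; apply H; exists (-1)%Z, 1%Z; split; [lia|simpl; field]. }
assert (x <> 1).
{ intros ->; apply H; exists 1%Z, 1%Z; split; [lia|simpl; field]. }
lra.
Qed.

Lemma irrational_not_node (x : R) (n : nat) : irrational x -> -1 < x -> ~ is_node n x.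
Proof.
intros H Hx [k [Hk E]]; apply H.
destruct n as [|n].
{ replace k with O in E by lia; rewrite node_0 in E; lra. }
exists (2 * Z.of_nat k - Z.of_nat (S n))%Z, (Z.of_nat (S n)); split; [lia|].
rewrite minus_IZR, mult_IZR, <- !INR_IZR_INZ, E; unfold node; field; apply not_0_INR; lia.
Qed.

Lemma regular_interior (x : R) (n : nat -> nat) :
  -1 <= x <= 1 -> strictly_incr n -> regular x n -> -1 < x < 1.
Proof.
intros Hx Hn [j0 Hj].
(* The index [S j0] forces a positive order, for which both endpoints are nodes. *)
specialize (Hj (S j0) ltac:(lia)); pose proof (strictly_incr_ge n Hn (S j0)).
assert (x <> -1).
{ intros ->; apply Hj; exists O; rewrite node_0; split; [lia|reflexivity]. }
assert (x <> 1).
{ intros ->; apply Hj; exists (n (S j0)); rewrite node_last by lia; split; [lia|reflexivity]. }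
lra.
Qed.

Lemma is_lim_seq_regular (u : nat -> R) (l x : R) (P : nat -> bool) (n : nat -> nat) :
  (forall eps, 0 < eps -> exists N, forall m, (N <= m)%nat -> P m = true -> ~ is_node m x ->
     Rabs (u m - l) <= eps) ->
  strictly_incr n -> (forall j, P (n j) = true) -> regular x n ->
  is_lim_seq (fun j => u (n j)) l.
Proof.
intros H Hn HP [j0 Hj0]; apply is_lim_seq_eps; intros eps Heps.
destruct (H eps Heps) as [N HN]; exists (Nat.max j0 N); intros j Hj.
pose proof (strictly_incr_ge n Hn j).
apply HN; [lia|apply HP|apply Hj0; lia].
Qed.

Lemma is_lim_seq_eventually_neq_0 (u : nat -> R) (l : R) :
  is_lim_seq u l -> l <> 0 -> eventually (fun j => u j <> 0).
Proof.
intros H Hl; apply is_lim_seq_spec in H.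
destruct (H (mkposreal (Rabs l) (Rabs_pos_lt l Hl))) as [N HN]; exists N; intros j Hj E.
specialize (HN j Hj); simpl in HN; rewrite E, Rminus_0_l, Rabs_Ropp in HN; lra.
Qed.

Definition scaled_error (f : R -> R) (x : R) (n : nat) : R := INR n * (Berrut n f x - f x).

Lemma scaled_error_mult (f : R -> R) (x : R) (n : nat) :
  (0 < n)%nat -> ~ is_node n x -> Db n x / INR n <> 0 ->
  scaled_error f x n * (Db n x / INR n) = Nb n f x - f x * Db n x.
Proof.
intros Hn Hx HD; apply lt_0_INR in Hn; unfold scaled_error, Berrut.
destruct ClassicalDescription.excluded_middle_informative as [H|_]; [contradiction|].
field; split; [lra|]; intros E; apply HD; rewrite E; field; lra.
Qed.

Lemma denominator_lim_seq (x : R) (n : nat -> nat) :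
  -1 < x < 1 -> strictly_incr n -> regular x n ->
  is_lim_seq (fun j => phase_sin x (n j) * (Db (n j) x / INR (n j))) (PI / 2).
Proof.
intros Hx Hn Hr.
apply (is_lim_seq_regular (fun m => phase_sin x m * (Db m x / INR m)) (PI / 2) x (fun _ => true));
  auto.
intros eps Heps; destruct (denominator_convergence x Hx eps Heps) as [N HN]; exists N; auto.
Qed.

(** The limit is kept in product form because [Db / n] need not converge when the phase varies. That
    [Db] is eventually nonzero follows from the limit [PI / 2]. *)
Lemma numerator_lim_seq (f : R -> R) (x sgn : R) (n : nat -> nat) :
  AC1 f -> -1 < x < 1 -> strictly_incr n -> (forall j, (-1) ^ n j = sgn) -> regular x n ->
  is_lim_seq (fun j => scaled_error f x (n j) * (Db (n j) x / INR (n j)))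
    (numerator_limit f x sgn).
Proof.
intros HAC Hx Hn Hsgn Hr.
apply is_lim_seq_ext_loc with (fun j => Nb (n j) f x - f x * Db (n j) x).
- pose proof (denominator_lim_seq x n Hx Hn Hr) as HD; apply is_lim_seq_eventually_neq_0 in HD.
  2: { pose proof PI_RGT_0; lra. }
  destruct HD as [N HN]; destruct Hr as [j0 Hj0].
  exists (Nat.max (S N) j0); intros j Hj; symmetry; apply scaled_error_mult.
  + pose proof (strictly_incr_ge n Hn j); lia.
  + apply Hj0; lia.
  + intros E; apply (HN j ltac:(lia)); rewrite E; ring.
- apply is_lim_seq_eps; intros eps Heps.
  destruct (numerator_convergence f x HAC Hx eps Heps) as [N HN]; destruct Hr as [j0 Hj0].
  exists (Nat.max N j0); intros j Hj; rewrite <- (Hsgn j).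
  pose proof (strictly_incr_ge n Hn j); apply HN; [lia|apply Hj0; lia].
Qed.

Lemma quotient_lim (w d : nat -> R) (A r : R) :
  is_lim_seq (fun j => w j * d j) A -> is_lim_seq d r -> r <> 0 -> is_lim_seq w (A / r).
Proof.
intros Hw Hd Hr.
apply is_lim_seq_ext_loc with (fun j => w j * d j / d j).
- destruct (is_lim_seq_eventually_neq_0 d r Hd Hr) as [N HN].
  exists N; intros j Hj; field; apply HN; exact Hj.
- apply is_lim_seq_div'; auto.
Qed.

(** Writing [w = (w d) s / (s d)] avoids any limit of [d], which is unbounded when [sigma = 0]. *)
Lemma phase_quotient_lim (w s d : nat -> R) (A sigma : R) :
  is_lim_seq (fun j => w j * d j) A -> is_lim_seq (fun j => s j * d j) (PI / 2) ->
  is_lim_seq s sigma -> is_lim_seq w (2 * A * sigma / PI).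
Proof.
intros Hw Hd Hs; pose proof PI_RGT_0 as HPI.
apply is_lim_seq_ext_loc with (fun j => w j * d j * s j / (s j * d j)).
- destruct (is_lim_seq_eventually_neq_0 _ _ Hd ltac:(lra)) as [N HN].
  exists N; intros j Hj; specialize (HN j Hj); field.
  split; intros E; apply HN; rewrite E; ring.
- replace (Finite (2 * A * sigma / PI)) with (Finite (A * sigma / (PI / 2)))
    by (f_equal; field; lra).
  apply is_lim_seq_div'; [apply is_lim_seq_mult'; auto|exact Hd|lra].
Qed.

(** Since [Rabs s <= 1], [Rabs w] is at most [Rabs (w d) / Rabs (s d)], whose limit is finite; this
    also excludes infinite [L]. *)
Lemma phase_quotient_bound (w s d : nat -> R) (A : R) (L : Rbar) :
  is_lim_seq (fun j => w j * d j) A -> is_lim_seq (fun j => s j * d j) (PI / 2) ->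
  (forall j, Rabs (s j) <= 1) -> is_lim_seq w L -> in_sym_interval (2 * Rabs A / PI) L.
Proof.
intros Hw Hd Hs HL; pose proof PI_RGT_0 as HPI.
assert (HB : Rbar_le (Rbar_abs L) (2 * Rabs A / PI)).
{ replace (Finite (2 * Rabs A / PI)) with (Finite (Rabs A / Rabs (PI / 2)))
    by (f_equal; rewrite (Rabs_pos_eq (PI / 2)) by lra; field; lra).
  apply (is_lim_seq_le_loc (fun j => Rabs (w j))
    (fun j => Rabs (w j * d j) / Rabs (s j * d j))).
  - destruct (is_lim_seq_eventually_neq_0 _ _ Hd ltac:(lra)) as [N HN].
    exists N; intros j Hj; specialize (HN j Hj).
    apply Rle_div_r; [apply Rabs_pos_lt; exact HN|].
    rewrite !Rabs_mult; specialize (Hs j).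
    pose proof (Rabs_pos (w j)); pose proof (Rabs_pos (d j)).
    assert (0 <= Rabs (w j) * Rabs (d j)) by (apply Rmult_le_pos; auto); nra.
  - apply (is_lim_seq_abs _ _ HL).
  - apply is_lim_seq_div'.
    + apply (is_lim_seq_abs _ _ Hw).
    + apply (is_lim_seq_abs _ _ Hd).
    + apply Rabs_no_R0; lra. }
destruct L as [l| |]; simpl in HB; try contradiction.
apply Rabs_le_between in HB; split; simpl; lra.
Qed.

(** [Ocal x] and [Ecal x] are, by conversion, the instances [Nat.odd] and [Nat.even]. *)
Definition denominator_limits (P : nat -> bool) (x : R) (y : Rbar) : Prop :=
  exists n : nat -> nat, strictly_incr n /\ (forall j, P (n j) = true) /\ regular x n /\
    is_lim_seq (fun j => Db (n j) x / INR (n j)) y.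

(** Some residue modulo the period recurs infinitely often. Along it the phase factor is a nonzero
    constant, so the denominator itself converges. *)
Lemma rational_subsequence (x : R) (Q K : nat) (n : nat -> nat) :
  (0 < Q)%nat -> INR Q * ((x + 1) / 2) = 2 * INR K ->
  -1 < x < 1 -> strictly_incr n -> regular x n ->
  exists phi r, strictly_incr phi /\ strictly_incr (fun j => n (phi j)) /\
    regular x (fun j => n (phi j)) /\ (r < Q)%nat /\ phase_sin x r <> 0 /\
    is_lim_seq (fun j => Db (n (phi j)) x / INR (n (phi j))) (PI / (2 * phase_sin x r)).
Proof.
intros HQ HK Hx Hn Hr; pose proof PI_RGT_0 as HPI.
destruct (pigeonhole_infinite Q (fun j => n j mod Q)%nat O) as [r [HrQ Hinf]].
{ intros j _; apply Nat.mod_upper_bound; lia. }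
destruct (strictly_incr_choice (fun _ j => n j mod Q = r)%nat) as [phi [Hphi Hmod]].
{ intros _; exact Hinf. }
assert (Hs : forall j, phase_sin x (n (phi j)) = phase_sin x r).
{ intros j; rewrite (phase_sin_mod x Q K HK), Hmod; reflexivity. }
assert (Hnphi : strictly_incr (fun j => n (phi j))) by (intros i j Hij; apply Hn, Hphi, Hij).
assert (Hreg : regular x (fun j => n (phi j))).
{ destruct Hr as [j0 Hj0]; exists j0; intros j Hj; apply Hj0.
  pose proof (strictly_incr_ge phi Hphi j); lia. }
assert (Hs0 : phase_sin x r <> 0).
{ destruct Hreg as [j0 Hj0]; rewrite <- (Hs (S j0)); apply phase_sin_neq_0; auto.
  pose proof (strictly_incr_ge _ Hnphi (S j0)); simpl in *; lia. }
exists phi, r; repeat (split; [assumption|]).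
pose proof (denominator_lim_seq x _ Hx Hnphi Hreg) as HD.
replace (Finite (PI / (2 * phase_sin x r))) with (Finite (PI / 2 / phase_sin x r))
  by (f_equal; field; exact Hs0).
apply quotient_lim with (d := fun _ => phase_sin x r); [|apply is_lim_seq_const|exact Hs0].
apply is_lim_seq_ext with (2 := HD); intros j; rewrite Hs; ring.
Qed.

(** Every limit is [PI / (2 * phase_sin x r)] for a residue [r < Q]. At [x = 1] and [x = -1] no
    sequence is regular and the set is empty. *)
Lemma denominator_limits_finite (P : nat -> bool) (x : R) :
  -1 <= x <= 1 -> rational x -> finite_nonzero_real (denominator_limits P x).
Proof.
intros Hx Hrat; pose proof PI_RGT_0 as HPI.
destruct (classic (-1 < x < 1)) as [Hi|Hi].
- destruct (rational_period x Hrat ltac:(lra)) as (Q & K & HQ & HK).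
  assert (H : forall y, denominator_limits P x y ->
    exists r, (r < Q)%nat /\ phase_sin x r <> 0 /\ y = Finite (PI / (2 * phase_sin x r))).
  { intros y (n & Hn & _ & Hr & Hy).
    destruct (rational_subsequence x Q K n HQ HK Hi Hn Hr)
      as (phi & r & Hphi & _ & _ & HrQ & Hs & Hlim).
    exists r; repeat split; auto.
    apply (is_lim_seq_strictly_incr _ _ phi Hphi) in Hy.
    apply is_lim_seq_unique in Hy; apply is_lim_seq_unique in Hlim; congruence. }
  split.
  + exists (map (fun r => Finite (PI / (2 * phase_sin x r))) (seq 0 Q)).
    intros y Hy; destruct (H y Hy) as (r & HrQ & _ & ->).
    apply (in_map (fun r => Finite (PI / (2 * phase_sin x r)))), in_seq; lia.
  + intros y Hy; destruct (H y Hy) as (r & _ & Hs & ->).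
    exists (PI / (2 * phase_sin x r)); split; [reflexivity|].
    apply Rmult_integral_contrapositive; split; [lra|apply Rinv_neq_0_compat; lra].
- assert (H : forall y, ~ denominator_limits P x y).
  { intros y (n & Hn & _ & Hr & _); apply Hi; eapply regular_interior; eauto. }
  split; [exists nil|]; intros y Hy; destruct (H y Hy).
Qed.

Definition error_limits (P : nat -> bool) (A x : R) (L : Rbar) : Prop :=
  (irrational x /\ in_sym_interval (2 * Rabs A / PI) L) \/
  (rational x /\ exists r : R, denominator_limits P x (Finite r) /\ L = Finite (A / r)).

(** Both parities at once: [P] tests the parity, and the numbers [2 m + b] are members of the class
    among which the converse picks its sequence. *)
Lemma error_limits_characterization (f : R -> R) (x sgn : R) (P : nat -> bool) (b : nat) :
  AC1 f -> -1 <= x <= 1 ->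
  (forall n, P n = true -> (-1) ^ n = sgn) -> (forall m, P (2 * m + b)%nat = true) ->
  let A := numerator_limit f x sgn in
  (forall (n : nat -> nat) (L : Rbar),
     strictly_incr n -> (forall j, P (n j) = true) -> star f x n L ->
     (irrational x -> in_sym_interval (2 * Rabs A / PI) L) /\
     (rational x -> regular x n -> error_limits P A x L)) /\
  (forall L : Rbar, error_limits P A x L ->
     exists n : nat -> nat,
       strictly_incr n /\ (forall j, P (n j) = true) /\ regular x n /\ star f x n L).
Proof.
intros HAC Hx HP Hb A; pose proof PI_RGT_0 as HPI.
assert (Hirr : irrational x -> forall n, regular x n).
{ intros H n; exists O; intros j _; apply irrational_not_node; auto.
  apply irrational_interior; auto. }
split.
- intros n L Hn HPn HL; split.
  + intros H; pose proof (irrational_interior x H Hx) as Hi.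
    apply (phase_quotient_bound (fun j => scaled_error f x (n j)) (fun j => phase_sin x (n j))
      (fun j => Db (n j) x / INR (n j))); auto.
    * apply numerator_lim_seq; auto.
    * apply denominator_lim_seq; auto.
    * intros j; apply Rabs_le, SIN_bound.
  + intros Hrat Hr; right; split; [exact Hrat|].
    pose proof (regular_interior x n Hx Hn Hr) as Hi.
    destruct (rational_period x Hrat ltac:(lra)) as (Q & K & HQ & HK).
    destruct (rational_subsequence x Q K n HQ HK Hi Hn Hr)
      as (phi & r & Hphi & Hnphi & Hreg & _ & Hs & Hlim).
    exists (PI / (2 * phase_sin x r)); split.
    { exists (fun j => n (phi j)); auto. }
    (* The given limit is inherited by the subsequence, where it can be computed. *)
    apply (is_lim_seq_strictly_incr _ _ phi Hphi) in HL.
    apply is_lim_seq_unique in HL; rewrite <- HL; apply is_lim_seq_unique.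
    apply (quotient_lim (fun j => scaled_error f x (n (phi j)))
      (fun j => Db (n (phi j)) x / INR (n (phi j)))); auto.
    * apply (numerator_lim_seq f x sgn (fun j => n (phi j))); auto.
    * apply Rmult_integral_contrapositive; split; [lra|apply Rinv_neq_0_compat; lra].
- intros L [[H HL]|[Hrat (r & Hr & ->)]].
  + pose proof (irrational_interior x H Hx) as Hi.
    destruct L as [l| |]; destruct HL as [HL1 HL2]; simpl in HL1, HL2; try contradiction.
    (* [sigma] is the limit of the phase factor that yields [l]; when [A = 0] the interval reduces
       to 0 and any [sigma] will do. *)
    assert (Hsig : exists sigma, -1 <= sigma <= 1 /\ l = 2 * A * sigma / PI).
    { destruct (Req_dec A 0) as [E|E].
      - rewrite E, Rabs_R0 in *; exists 0; split; [lra|].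
        replace (2 * 0 / PI) with 0 in * by (field; lra); lra.
      - exists (l * PI / (2 * A)); split; [|field; lra].
        apply Rabs_le_between; rewrite Rabs_div, !Rabs_mult by lra.
        rewrite (Rabs_pos_eq PI), (Rabs_pos_eq 2) by lra.
        pose proof (Rabs_pos_lt A E).
        apply Rle_div_l; [lra|].
        assert (Rabs l <= 2 * Rabs A / PI) by (apply Rabs_le; lra).
        apply Rle_div_r in H1; lra. }
    destruct Hsig as (sigma & Hsig & ->).
    destruct (strictly_incr_choice
      (fun j n => P n = true /\ Rabs (phase_sin x n - sigma) < / (INR j + 1))) as [n [Hn Hlim]].
    { intros j N; destruct (phase_sin_dense x sigma b N (/ (INR j + 1)) H Hsig) as [m [Hm HS]].
      - apply Rinv_0_lt_compat; pose proof (pos_INR j); lra.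
      - exists (2 * m + b)%nat; repeat split; [lia|apply Hb|exact HS]. }
    exists n; repeat split; auto; [intros j; apply Hlim|].
    apply (phase_quotient_lim (fun j => scaled_error f x (n j)) (fun j => phase_sin x (n j))
      (fun j => Db (n j) x / INR (n j))).
    * apply numerator_lim_seq; auto; intros j; apply HP, Hlim.
    * apply denominator_lim_seq; auto.
    * apply is_lim_seq_eps; intros eps Heps.
      destruct (nfloor_ex (/ eps)) as [N HN]; [left; apply Rinv_0_lt_compat, Heps|].
      exists N; intros j Hj; left; apply Rlt_le_trans with (1 := proj2 (Hlim j)).
      rewrite <- (Rinv_inv eps); apply le_INR in Hj.
      apply Rinv_le_contravar; [apply Rinv_0_lt_compat, Heps|lra].
  (* The sequence that realizes [r] as a limit of denominators also realizes [A / r]. *)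
  + destruct (proj2 (denominator_limits_finite P x Hx Hrat) _ Hr) as (r' & E & Hr').
    injection E as <-; destruct Hr as (n & Hn & HPn & Hreg & Hlim).
    pose proof (regular_interior x n Hx Hn Hreg) as Hi.
    exists n; repeat split; auto.
    apply (quotient_lim (fun j => scaled_error f x (n j)) (fun j => Db (n j) x / INR (n j))); auto.
    apply numerator_lim_seq; auto.
Qed.

(** Valid at the endpoints too, since inversion with [/ 0 = 0] still commutes with products and
    opposites. *)
Lemma Ofun_numerator_limit (f : R -> R) (x : R) : Ofun f x = numerator_limit f x (-1).
Proof.
unfold Ofun, numerator_limit, slope, Rdiv; rewrite !Rinv_mult.
replace (1 - x) with (- (x - 1)) by ring; replace (-1 - x) with (- (x + 1)) by ring.
rewrite !Rinv_opp; ring.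
Qed.

Lemma Efun_numerator_limit (f : R -> R) (x : R) : Efun f x = numerator_limit f x 1.
Proof.
unfold Efun, numerator_limit, slope, Rdiv; rewrite !Rinv_mult.
replace (1 - x) with (- (x - 1)) by ring; replace (-1 - x) with (- (x + 1)) by ring.
rewrite !Rinv_opp; ring.
Qed.

Lemma pow_odd (n : nat) : Nat.odd n = true -> (-1) ^ n = -1.
Proof. intros H; apply Nat.odd_spec in H; destruct H as [m ->]; rewrite Nat.add_1_r; apply pow_1_odd. Qed.

Lemma pow_even (n : nat) : Nat.even n = true -> (-1) ^ n = 1.
Proof. intros H; apply Nat.even_spec in H; destruct H as [m ->]; apply pow_1_even. Qed.

Theorem theorem1 (f : R -> R) (x : R) :
  AC1 f -> -1 <= x <= 1 ->
  (* (i) odd sequences *)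
  ((forall (n : nat -> nat) (L : Rbar),
      strictly_incr n -> odd_seq n -> star f x n L ->
      (irrational x -> in_sym_interval (2 * Rabs (Ofun f x) / PI) L) /\
      (rational x -> regular x n -> OfxSet f x L)) /\
   (rational x -> finite_nonzero_real (Ocal x)) /\
   ((irrational x \/ (rational x /\ -1 < x < 1)) ->
      forall L : Rbar, OfxSet f x L ->
      exists n : nat -> nat, strictly_incr n /\ odd_seq n /\ regular x n /\ star f x n L)) /\
  (* (ii) even sequences *)
  ((forall (n : nat -> nat) (L : Rbar),
      strictly_incr n -> even_seq n -> star f x n L ->
      (irrational x -> in_sym_interval (2 * Rabs (Efun f x) / PI) L) /\
      (rational x -> regular x n -> EfxSet f x L)) /\
   (rational x -> finite_nonzero_real (Ecal x)) /\
   (forall L : Rbar, EfxSet f x L ->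
      exists n : nat -> nat, strictly_incr n /\ even_seq n /\ regular x n /\ star f x n L)).
Proof.
intros HAC Hx; unfold OfxSet, EfxSet; rewrite Ofun_numerator_limit, Efun_numerator_limit.
destruct (error_limits_characterization f x (-1) Nat.odd 1 HAC Hx pow_odd) as [O1 O2].
{ intros m; apply Nat.odd_spec; exists m; reflexivity. }
destruct (error_limits_characterization f x 1 Nat.even 0 HAC Hx pow_even) as [E1 E2].
{ intros m; apply Nat.even_spec; exists m; lia. }
split; split.
- exact O1.
- split; [exact (denominator_limits_finite Nat.odd x Hx)|].
  intros _; exact O2.
- exact E1.
- split; [exact (denominator_limits_finite Nat.even x Hx)|exact E2].
Qed.
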